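(* Let $\alpha\in\mathbb{Z}_{\ge0}$, $x_1\in\mathbb{C}_p$, $R>0$ and $\mathcal{D} = D^{+}(x_{1}, R)\setminus D^{-}(x_{1}, R)$. Let $b \in \mathcal{D}$ (so that $|x_{1} - b|_{p} = R$). Let $x_{0} \in \mathcal{D}$ with $|x_{0} - b|_{p} = R$. Choose $a_{0} \in D^{+}(x_{1},R)$ so that $|a_{0} - b|_{p} = |a_{0} - x_{1}|_{p} = R$, and let $a_{1} = x_{1}$. Put $$\mathbf{D} = \det \left(\frac{1}{1 - \omega\left( \frac{a_{i} - x_{j}}{a_{i} - b}\right)^{p^{\alpha}}}\right)_{0 \leq i,j \leq 1}.$$ Let $f$ be a Krasner analytic function on $\mathcal{D}$. Then, if $|z - x_{0}|_{p} < R$ and $\mathbf{D} \neq 0$, $$f(z) = \frac{1}{\mathbf{D}}\left(\int_{\mathcal{A}(a_{0},b),\Phi_{\alpha}}\frac{f(x)}{x - z}\,dx - \frac{1}{1 - \omega\left( \frac{a_{0} - x_{1}}{a_{0} - b}\right)^{p^{\alpha}}}\int_{\mathcal{A}(x_{1},b),\Phi_{\alpha}}\frac{f(x)}{x - z}\,dx\right).$$ Furthermore, $a_{0}$ can always be chosen (subject to the conditions $a_{0} \in D^{+}(x_{1},R)$ and $|a_{0} - b|_{p} = |a_{0} - x_{1}|_{p} = R$) so that $\mathbf{D} \neq 0$.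
   Context: $p$ is an odd prime; $\mathbb{C}_p$ is the completion of an algebraic closure of $\mathbb{Q}_p$, with $|p|_p=1/p$. $D^+(c,r)$ and $D^-(c,r)$ are the closed and open discs with center $c$ and radius $r$. Arc: for $a\ne b$ in $\mathbb{C}_p$ with $R=|a-b|_p$, the arc $\mathcal{A}(a,b)$ is the open disc $\{x : |x-b|_p<R\}$. Path sequence: a function $\varphi$ defined for all integers $k\ge k_0$ (some $k_0\in\mathbb{Z}^+$), with values in $\mathbb{Z}^+$ and strictly increasing. For $f:\mathcal{A}(a,b)\to\mathbb{C}_p$ put $A_{f,\varphi}(k)=p^{-\varphi(k)}\sum_{\zeta}(x-a)f(x)$, where $x=a+(b-a)\zeta$ and $\zeta$ runs through the $p^{\varphi(k)}$-th roots of unity (so the integral below over $\mathcal{A}(a,b)$ depends on $a$ and $b$, not just on the disc). A non-empty family $\Phi$ of path sequences is interlocked if for all $\varphi_1,\varphi_2\in\Phi$ there are $\varphi_3\in\Phi$ and $k_0$ such that $\varphi_3(k)$, $k\ge k_0$, is a subsequence of both $\varphi_1$ and $\varphi_2$. For interlocked $\Phi$, $\int_{\mathcal{A}(a,b),\Phi}f(x)\,dx=L$ means: for every $\varepsilon>0$ there are $\varphi_\varepsilon\in\Phi$ and $K_\varepsilon$ with $|A_{f,\varphi_\varepsilon}(k)-L|_p<\varepsilon$ for all $k>K_\varepsilon$ (such $L$ is unique if it exists). For $\alpha\in\mathbb{Z}$, $\Phi_\alpha$ is the interlocked family $\{\varphi : \varphi(k)=\alpha+\lambda k,\ \lambda=1,2,\dots\}$.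 $\omega$ is the Teichmüller character: for $|x|_p=1$, $\omega(x)$ is the unique root of unity of order prime to $p$ with $|x-\omega(x)|_p<1$; $\omega(x)=0$ if $|x|_p<1$. A function on $\mathcal{D}$ (a closed disc with finitely many open discs removed) is Krasner analytic if it is the uniform limit on $\mathcal{D}$ of rational functions whose poles are outside $\mathcal{D}$. *)

(* Defs.v *)
From HB Require Import structures.
From mathcomp Require Import all_boot all_order all_algebra.
From mathcomp Require Import zify.
From mathcomp Require Import all_classical all_reals.

Set Implicit Arguments.
Unset Strict Implicit.
Unset Printing Implicit Defensive.

Import Order.TTheory GRing.Theory Num.Theory.

Local Open Scope classical_set_scope.
Local Open Scope ring_scope.

Section Cp.
Context {R : realType} {K : fieldType}.
Variable v : K -> R.

Record ultrametric_abs : Prop := UltrametricAbs {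
  uabs_ge0 : forall x, 0 <= v x;
  uabs_eq0 : forall x, v x = 0 <-> x = 0;
  uabsM : forall x y, v (x * y) = v x * v y;
  uabsD : forall x y, v (x + y) <= Num.max (v x) (v y) }.

Definition cauchy_seq_abs (u : nat -> K) : Prop :=
  forall e : R, 0 < e -> exists N : nat, forall m n : nat,
    (N <= m)%N -> (N <= n)%N -> v (u m - u n) < e.

Definition cvg_abs (u : nat -> K) (l : K) : Prop :=
  forall e : R, 0 < e -> exists N : nat, forall n : nat,
    (N <= n)%N -> v (u n - l) < e.

Definition closure_abs (A : set K) : set K :=
  [set x | forall e : R, 0 < e -> exists2 y, A y & v (x - y) < e].

(* Q_p inside a complete K with |p| = 1/p: the absolute value then restricts
   to the p-adic one on the rationals, and their closure is their completion *)
Definition Qp : set K := closure_abs (range (@ratr K)).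

Definition Qp_alg : set K :=
  [set x | exists P : {poly K}, [/\ P != 0, forall i : nat, Qp P`_i & root P x]].

(* (K, v) is a completion of an algebraic closure of Q_p: K is complete, Qp_alg
   (algebraic over Q_p by definition) is algebraically closed, and it is dense
   in K; this determines (K, v) up to isometric isomorphism *)
Record is_Cp (p : nat) : Prop := IsCp {
  Cp_abs : ultrametric_abs;
  Cp_abs_p : v p%:R = p%:R^-1;
  Cp_complete : forall u : nat -> K,
    cauchy_seq_abs u -> exists l, cvg_abs u l;
  Cp_alg_closed : forall P : {poly K}, (1 < size P)%N ->
    (forall i : nat, Qp_alg P`_i) -> exists2 x, Qp_alg x & root P x;
  Cp_alg_dense : closure_abs Qp_alg = setT }.

Definition closed_disc (c : K) (r : R) : set K := [set x | v (x - c) <= r].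
Definition open_disc (c : K) (r : R) : set K := [set x | v (x - c) < r].

(* The n-th approximant is P.[x] / Q.[x] with (P, Q) = g n; a rational function
   has its poles outside D iff it has a denominator without zeros in D *)
Definition krasner_analytic (D : set K) (f : K -> K) : Prop :=
  exists g : nat -> {poly K} * {poly K},
    (forall n x, D x -> (g n).2.[x] != 0) /\
    forall e : R, 0 < e -> exists N : nat, forall n : nat, (N <= n)%N ->
      forall x, D x -> v (f x - (g n).1.[x] / (g n).2.[x]) < e.

(* The value is only meant for v x <= 1; it is 0 when v x > 1 *)
Definition teichmuller (p : nat) (x : K) : K :=
  if v x == 1 then
    xget 0 [set w | (exists2 m : nat, coprime p m & m.-primitive_root w) /\
                    v (x - w) < 1]
  else 0.

Definition teich_matrix (p alpha n : nat) (b : K) (a x : 'I_n -> K) : 'M[K]_n :=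
  \matrix_(i, j)
    (1 / (1 - teichmuller p ((a i - x j) / (a i - b)) ^+ (p ^ alpha))).

End Cp.

(* ps_fun is only meaningful on the indices k >= ps_start *)
Record path_seq := PathSeq {
  ps_start : nat;
  ps_fun :> nat -> nat;
  ps_start_gt0 : (0 < ps_start)%N;
  ps_gt0 : forall k, (ps_start <= k)%N -> (0 < ps_fun k)%N;
  ps_incr : forall k l, (ps_start <= k)%N -> (k < l)%N ->
    (ps_fun k < ps_fun l)%N }.

Definition tail_subseq (phi psi : path_seq) (k0 : nat) : Prop :=
  exists h : nat -> nat,
    (forall k l, (k0 <= k)%N -> (k < l)%N -> (h k < h l)%N) /\
    forall k, (k0 <= k)%N -> (ps_start psi <= h k)%N /\ phi k = psi (h k).

Record interlocked_family := InterlockedFamily {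
  il_set : set path_seq;
  il_nonempty : il_set !=set0;
  il_interlocked : forall phi1 phi2, il_set phi1 -> il_set phi2 ->
    exists2 phi3, il_set phi3 &
      exists k0 : nat, [/\ (ps_start phi3 <= k0)%N,
        tail_subseq phi3 phi1 k0 & tail_subseq phi3 phi2 k0] }.

Definition Phi_set (alpha : int) : set path_seq :=
  [set phi | exists2 lambda : nat, (0 < lambda)%N &
     forall k, (ps_start phi <= k)%N ->
       (phi k)%:Z = alpha + (lambda * k)%N%:Z].

Lemma Phi_member (alpha : int) (lambda : nat) : (0 < lambda)%N ->
  exists2 phi : path_seq, ps_start phi = (absz alpha).+1 &
    forall k, (ps_start phi <= k)%N -> (phi k)%:Z = alpha + (lambda * k)%N%:Z.
Proof.
move=> l0.
have val k : ((absz alpha).+1 <= k)%N ->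
    (absz (alpha + (lambda * k)%N%:Z)%R)%:Z = alpha + (lambda * k)%N%:Z.
  move=> hk; have : (k <= lambda * k)%N by rewrite leq_pmull.
  by lia.
have pos k : ((absz alpha).+1 <= k)%N -> (0 < absz (alpha + (lambda * k)%N%:Z)%R)%N.
  move=> hk; have : (k <= lambda * k)%N by rewrite leq_pmull.
  by lia.
have incr k l : ((absz alpha).+1 <= k)%N -> (k < l)%N ->
    (absz (alpha + (lambda * k)%N%:Z)%R < absz (alpha + (lambda * l)%N%:Z)%R)%N.
  move=> hk hl; have := val k hk; have := val l (leq_trans hk (ltnW hl)).
  have : (lambda * k < lambda * l)%N by rewrite ltn_pmul2l.
  by lia.
by exists (PathSeq (ltn0Sn _) pos incr).
Qed.

Lemma Phi_nonempty (alpha : int) : Phi_set alpha !=set0.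
Proof.
by have [phi _ h] := @Phi_member alpha 1 isT; exists phi; exists 1%N.
Qed.

Lemma Phi_interlocked (alpha : int) (phi1 phi2 : path_seq) :
  Phi_set alpha phi1 -> Phi_set alpha phi2 ->
  exists2 phi3, Phi_set alpha phi3 &
    exists k0 : nat, [/\ (ps_start phi3 <= k0)%N,
      tail_subseq phi3 phi1 k0 & tail_subseq phi3 phi2 k0].
Proof.
move=> [l1 l1_gt0 h1] [l2 l2_gt0 h2].
have l12 : (0 < l1 * l2)%N by rewrite muln_gt0 l1_gt0.
have [phi _ h] := Phi_member alpha l12.
exists phi; first by exists (l1 * l2)%N.
exists (ps_start phi + ps_start phi1 + ps_start phi2)%N; split; first by lia.
- exists (fun k => (l2 * k)%N); split=> [k l _ kl|k hk]; first by rewrite ltn_pmul2l.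
  have le : (k <= l2 * k)%N by rewrite leq_pmull.
  have s1 : (ps_start phi1 <= l2 * k)%N by lia.
  split=> //; apply/eqP; rewrite -eqz_nat h1 // h ?mulnA //; lia.
- exists (fun k => (l1 * k)%N); split=> [k l _ kl|k hk]; first by rewrite ltn_pmul2l.
  have le : (k <= l1 * k)%N by rewrite leq_pmull.
  have s1 : (ps_start phi2 <= l1 * k)%N by lia.
  split=> //; apply/eqP; rewrite -eqz_nat h2 // h ?mulnA ?(mulnC l2) //; lia.
Qed.

Definition Phi (alpha : int) : interlocked_family :=
  InterlockedFamily (Phi_nonempty alpha) (@Phi_interlocked alpha).

Section ArcIntegral.
Context {R : realType} {K : fieldType}.
Variables (v : K -> R) (p : nat).

(* f is evaluated only at points a + (b - a) * zeta, with zeta a root of unity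
   of p-power order; these lie in the arc, the open disc of center b and
   radius v (a - b) *)
Definition arc_sum (a b : K) (f : K -> K) (phi : path_seq) (k : nat) : K :=
  (p ^ phi k)%:R^-1 *
  \sum_(zeta \in [set zeta : K | (p ^ phi k)%N.-unity_root zeta])
     (let x := a + (b - a) * zeta in (x - a) * f x).

Definition is_arc_integral (a b : K) (F : interlocked_family) (f : K -> K)
    (L : K) : Prop :=
  forall e : R, 0 < e -> exists2 phi : path_seq, il_set F phi &
    exists N : nat, forall k : nat, (ps_start phi <= k)%N -> (N < k)%N ->
      v (arc_sum a b f phi k - L) < e.

Definition arc_integrable (a b : K) (F : interlocked_family) (f : K -> K) : Prop :=
  exists L, is_arc_integral a b F f L.

Definition arc_integral (a b : K) (F : interlocked_family) (f : K -> K) : K :=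
  xget 0 [set L | is_arc_integral a b F f L].

End ArcIntegral.

(* Main.v *)
(** For a polynomial or a Laurent monomial, the arc sums are averages over the
    roots of unity of order [N = p ^ phi k], and they can be computed: a simple
    pole [c] outside the arc contributes [1 / (1 - u ^+ N)] with
    [u = (a - c) / (a - b)], which tends to the matrix entry of [c]; poles of
    higher order and polynomials contribute [0] in the limit.

    In the coordinate [Y = (x - x1) / (b - x1)], a Krasner analytic function on
    [D] is a uniform limit of Laurent polynomials in [Y], whose coefficients are
    bounded by the supremum on [D].  Since [1 / (zeta - u)] agrees on the
    [N]-th roots of unity with a polynomial with integral coefficients, the arc
    sums are bounded by that supremum too, uniformly in [k] despite the factor
    [1 / N]; so everything passes to the limit.  Both integrals of
    [f x / (x - z)] then have the form "entry of [x0] times [f z], plus entry of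
    [x1] times the same residue", and the formula eliminates the residue.

    For the determinant, write [s = (x1 - x0) / (x1 - b)] and let [E] be [1]
    minus the [p ^ alpha]-th power of the Teichmuller value of [s].  If the
    determinant vanished for every [a0], applying this to
    [(a0 - x1) / (a0 - b) = 1 - (1 - s) ^+ n] for [n = 1, 2, ...] would make
    every [1 - E ^+ n] a root of unity or [0], and [E] a primitive [N]-th root
    of unity with [N > 1]; then the integer
    [N = \prod_(1 <= n < N) (1 - E ^+ n)] would be a root of unity. *)
Require Import Defs.
From HB Require Import structures.
From mathcomp Require Import all_boot all_order all_algebra.
From mathcomp Require Import all_solvable all_field.
From mathcomp Require Import zify ring lra.
From mathcomp Require Import all_classical all_reals.

Set Implicit Arguments.
Unset Strict Implicit.
Unset Printing Implicit Defensive.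

Import Order.TTheory GRing.Theory Num.Theory.

Local Open Scope classical_set_scope.
Local Open Scope ring_scope.

(** By Bernoulli's inequality the powers of [c^-1] grow at least linearly, so they exceed [e^-1]. *)
Lemma expr_lt_eps (R : realType) (c e : R) : 0 <= c < 1 -> 0 < e ->
  exists n : nat, c ^+ n < e.
Proof.
move=> /andP[c0 c1] e0; have [->|cn0] := eqVneq c 0.
  by exists 1%N; rewrite expr1.
have cp : 0 < c by rewrite lt_def cn0.
have d0 : 0 < c^-1 - 1 by rewrite subr_gt0 invf_gt1.
pose n := Num.bound (e^-1 / (c^-1 - 1)); exists n.
have hn : e^-1 < n%:R * (c^-1 - 1).
  by rewrite -ltr_pdivrMr // archi_boundP // divr_ge0 ?invr_ge0 // ltW.
have bern m : 1 + m%:R * (c^-1 - 1) <= c^-1 ^+ m.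
  elim: m => [|m IH]; first by rewrite mul0r addr0 expr0.
  have m0 : 0 <= m%:R :> R by [].
  rewrite exprS -natr1; set x := c^-1 in IH d0 *.
  have : x * (1 + m%:R * (x - 1)) <= x * x ^+ m by rewrite ler_wpM2l // ltW //; lra.
  apply: le_trans; rewrite -subr_ge0.
  have -> : x * (1 + m%:R * (x - 1)) - (1 + (m%:R + 1) * (x - 1)) = m%:R * (x - 1) ^+ 2.
    by ring.
  by rewrite mulr_ge0 // sqr_ge0.
have : e^-1 < (c ^+ n)^-1.
  by rewrite -exprVn; apply: lt_le_trans (bern n); lra.
by rewrite ltf_pV2 // posrE // exprn_gt0.
Qed.

(** * Ultrametric absolute values and convergence *)

Section Ultrametric.
Context {R : realType} {K : fieldType}.
Variables (v : K -> R) (v_abs : ultrametric_abs v).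

Lemma v_ge0 x : 0 <= v x. Proof. exact: uabs_ge0. Qed.

Lemma vM x y : v (x * y) = v x * v y. Proof. exact: uabsM. Qed.

Lemma v0 : v 0 = 0. Proof. exact/(uabs_eq0 v_abs). Qed.

Lemma v_eq0 x : (v x == 0) = (x == 0).
Proof. by apply/eqP/eqP => /(uabs_eq0 v_abs). Qed.

Lemma v_gt0 x : (0 < v x) = (x != 0).
Proof. by rewrite lt_def v_eq0 v_ge0 andbT. Qed.

Lemma v1 : v 1 = 1.
Proof.
have n0 : v 1 != 0 by rewrite v_eq0 oner_eq0.
by apply: (mulfI n0); rewrite -vM !mulr1.
Qed.

Lemma vX x n : v (x ^+ n) = v x ^+ n.
Proof. by elim: n => [|n IH]; rewrite ?v1 // !exprS vM IH. Qed.

Lemma vN x : v (- x) = v x.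
Proof.
have h : v (-1) = 1.
  apply/eqP; rewrite -(@eqrXn2 _ 2) ?v_ge0 // -vX sqrrN !expr1n v1 //.
by rewrite -mulN1r vM h mul1r.
Qed.

Lemma vBC x y : v (x - y) = v (y - x).
Proof. by rewrite -vN opprB. Qed.

Lemma vV x : v x^-1 = (v x)^-1.
Proof.
have [->|x0] := eqVneq x 0; first by rewrite invr0 v0 invr0.
have n0 : v x != 0 by rewrite v_eq0.
by apply: (mulfI n0); rewrite -vM !mulfV // v1.
Qed.

Lemma v_div x y : v (x / y) = v x / v y.
Proof. by rewrite vM vV. Qed.

Lemma v_prod (I : Type) (r : seq I) (P : pred I) (F : I -> K) :
  v (\prod_(i <- r | P i) F i) = \prod_(i <- r | P i) v (F i).
Proof. exact: (big_morph v vM v1). Qed.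

Lemma vD_le x y e : v x <= e -> v y <= e -> v (x + y) <= e.
Proof. by move=> hx hy; rewrite (le_trans (uabsD v_abs x y)) // ge_max hx hy. Qed.

Lemma vD_lt x y e : v x < e -> v y < e -> v (x + y) < e.
Proof. by move=> hx hy; rewrite (le_lt_trans (uabsD v_abs x y)) // gt_max hx hy. Qed.

Lemma vB_le x y e : v x <= e -> v y <= e -> v (x - y) <= e.
Proof. by move=> hx hy; apply: vD_le; rewrite ?vN. Qed.

Lemma vB_lt x y e : v x < e -> v y < e -> v (x - y) < e.
Proof. by move=> hx hy; apply: vD_lt; rewrite ?vN. Qed.

Lemma v_dist_lt y x z e : v (x - y) < e -> v (y - z) < e -> v (x - z) < e.
Proof. by move=> hx hy; rewrite -(subrK y x) -addrA; apply: vD_lt. Qed.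

Lemma v_dist_le y x z e : v (x - y) <= e -> v (y - z) <= e -> v (x - z) <= e.
Proof. by move=> hx hy; rewrite -(subrK y x) -addrA; apply: vD_le. Qed.

Lemma v_sum_le (I : Type) (r : seq I) (P : pred I) (F : I -> K) (e : R) :
  0 <= e -> (forall i, P i -> v (F i) <= e) -> v (\sum_(i <- r | P i) F i) <= e.
Proof.
move=> e0 hF; apply: (big_ind (fun x => v x <= e)) => //; first by rewrite v0.
by move=> x y; apply: vD_le.
Qed.

Lemma v_sum_lt (I : Type) (r : seq I) (P : pred I) (F : I -> K) (e : R) :
  0 < e -> (forall i, P i -> v (F i) < e) -> v (\sum_(i <- r | P i) F i) < e.
Proof.
move=> e0 hF; apply: (big_ind (fun x => v x < e)) => //; first by rewrite v0.
by move=> x y; apply: vD_lt.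
Qed.

Lemma vDl x y : v y < v x -> v (x + y) = v x.
Proof.
move=> h; apply/eqP; rewrite eq_le vD_le ?(ltW h) //= leNgt; apply/negP => h'.
have : v (x + y - y) < v x by apply: vB_lt.
by rewrite addrK ltxx.
Qed.

Lemma vDr x y : v x < v y -> v (x + y) = v y.
Proof. by move=> h; rewrite addrC vDl. Qed.

Lemma v_eq_near x y : v (x - y) < v y -> v x = v y.
Proof. by move=> h; rewrite -{1}(subrK y x) vDr. Qed.

Lemma v_nat n : v n%:R <= 1.
Proof.
elim: n => [|n IH]; first by rewrite v0.
by rewrite -natr1 vD_le ?v1.
Qed.

Lemma v_int (n : int) : v n%:~R <= 1.
Proof. by case: n => n; rewrite ?NegzE ?mulrNz ?vN v_nat. Qed.

Lemma vX_le1 x n : v x <= 1 -> v (x ^+ n) <= 1.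
Proof. by move=> h; rewrite vX exprn_ile1 ?v_ge0. Qed.

Lemma vM_le x y e : v x <= 1 -> v y <= e -> v (x * y) <= e.
Proof.
move=> hx hy; rewrite vM (le_trans _ hy) // -[leRHS]mul1r ler_wpM2r ?v_ge0 //.
Qed.

Lemma v_unity x n : (0 < n)%N -> x ^+ n = 1 -> v x = 1.
Proof.
move=> n0 h; apply/eqP.
by rewrite -(@eqrXn2 _ n) ?v_ge0 // -vX h expr1n v1.
Qed.

Lemma horner_close (P : {poly K}) (y : K) (e B : R) (d : nat) :
  0 < e -> 1 <= B -> v y <= B -> (size P <= d.+1)%N ->
  (forall i, v P`_i < e) -> v P.[y] < e * B ^+ d.
Proof.
move=> e0 B1 yB sP hP; rewrite (horner_coef_wide _ sP).
have Bd : 1 <= B ^+ d by rewrite exprn_ege1.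
apply: v_sum_lt => [|i _]; first by rewrite mulr_gt0 // (lt_le_trans ltr01).
rewrite vM; apply: (@le_lt_trans _ _ (v P`_i * B ^+ d)).
  rewrite ler_wpM2l ?v_ge0 // vX (@le_trans _ _ (B ^+ i)) //.
    by rewrite lerXn2r ?nnegrE ?v_ge0 // (le_trans ler01).
  by rewrite ler_weXn2l // -ltnS.
by rewrite ltr_pM2r // (lt_le_trans ltr01).
Qed.

Lemma cvg_abs_unique (u : nat -> K) l l' : cvg_abs v u l -> cvg_abs v u l' -> l = l'.
Proof.
move=> h h'; apply/eqP; rewrite -subr_eq0 -v_eq0 eq_le v_ge0 andbT.
apply/ler_addgt0Pr => e e0; rewrite add0r.
have [N hN] := h e e0; have [N' hN'] := h' e e0; apply: ltW.
apply: (v_dist_lt (y := u (maxn N N'))); last by rewrite hN' ?leq_maxr.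
by rewrite vBC hN ?leq_maxl.
Qed.

Lemma cvg_absD u u' l l' : cvg_abs v u l -> cvg_abs v u' l' ->
  cvg_abs v (fun k => u k + u' k) (l + l').
Proof.
move=> h h' e e0; have [N hN] := h e e0; have [N' hN'] := h' e e0.
exists (maxn N N') => n; rewrite geq_max => /andP[n1 n2].
by rewrite opprD addrACA; apply: vD_lt; [apply: hN|apply: hN'].
Qed.

Lemma cvg_absZ u l c : cvg_abs v u l -> cvg_abs v (fun k => c * u k) (c * l).
Proof.
move=> h e e0; have [->|c0] := eqVneq c 0.
  by exists 0%N => n _; rewrite !mul0r subr0 v0.
have cp : 0 < v c by rewrite v_gt0.
have [|N hN] := h (e / v c); first by rewrite divr_gt0.
by exists N => n hn; rewrite -mulrBr vM mulrC -ltr_pdivlMr ?hN.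
Qed.

Lemma cvg_abs_cst l : cvg_abs v (fun=> l) l.
Proof. by move=> e e0; exists 0%N => n _; rewrite subrr v0. Qed.

Lemma cvg_abs_sum (I : Type) (r : seq I) (F : I -> nat -> K) (l : I -> K) :
  (forall i, cvg_abs v (F i) (l i)) ->
  cvg_abs v (fun k => \sum_(i <- r) F i k) (\sum_(i <- r) l i).
Proof.
move=> h; elim: r => [|i r IH].
  rewrite big_nil; under [X in cvg_abs _ X]funext do rewrite big_nil.
  exact: cvg_abs_cst.
rewrite big_cons; under [X in cvg_abs _ X]funext do rewrite big_cons.
exact: cvg_absD.
Qed.

End Ultrametric.

(** * The embedding of the rationals into a field of characteristic zero *)

Section RationalEmbedding.
Context {K : fieldType}.
Hypothesis char0 : forall n : nat, (n.+1%:R : K) != 0.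

Let int_neq0 (d : int) : d != 0 -> d%:~R != 0 :> K.
Proof.
case: d => [[|n]|n] // _; first exact: char0.
by rewrite NegzE mulrNz oppr_eq0; apply: char0.
Qed.

Lemma ratr_frac (n d : int) : d != 0 ->
  ratr (n%:~R / d%:~R) = n%:~R / d%:~R :> K.
Proof.
move=> d0; set q : rat := n%:~R / d%:~R; rewrite /ratr.
apply/eqP; rewrite eqr_div ?int_neq0 ?denq_neq0 // -!intrM; apply/eqP; congr _%:~R.
apply: (@intr_inj rat); rewrite !intrM.
have dq : (d%:~R : rat) != 0 by rewrite intr_eq0.
have eq0 : ((denq q)%:~R : rat) != 0 by rewrite intr_eq0 denq_neq0.
have : (numq q)%:~R / (denq q)%:~R = n%:~R / d%:~R :> rat by rewrite divq_num_den.
by move/eqP; rewrite eqr_div // => /eqP.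
Qed.

(** [ratr] is computed from the reduced fraction; [ratr_frac] allows unreduced ones, and the usual
    formulas for sums and products then carry over. *)
Lemma ratr_rmorph : exists f : {rmorphism rat -> K}, (f : rat -> K) = ratr.
Proof.
have repr (x : rat) : exists n d : int, d != 0 /\ x = n%:~R / d%:~R.
  by exists (numq x), (denq x); rewrite denq_neq0 divq_num_den.
have rB : zmod_morphism (@ratr K).
  move=> x y; have [n [d [d0 ->]]] := repr x; have [m [e [e0 ->]]] := repr y.
  have [d0' e0'] := (int_neq0 d0, int_neq0 e0).
  have -> : n%:~R / d%:~R - m%:~R / e%:~R = (n * e - m * d)%:~R / (d * e)%:~R :> rat.
    have dq : (d%:~R : rat) != 0 by rewrite intr_eq0.
    have eq : (e%:~R : rat) != 0 by rewrite intr_eq0.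
    by rewrite !rmorphB !rmorphM /=; field; rewrite dq eq.
  rewrite !ratr_frac ?mulf_neq0 // rmorphB !rmorphM /=.
  by field; rewrite d0' e0'.
have rM : monoid_morphism (@ratr K).
  split=> [|x y]; first by rewrite /ratr divr1.
  have [n [d [d0 ->]]] := repr x; have [m [e [e0 ->]]] := repr y.
  by rewrite mulf_div -!rmorphM /= !ratr_frac ?mulf_neq0 // !rmorphM mulf_div.
pose a := GRing.isZmodMorphism.Build rat K (@ratr K) rB.
pose m := GRing.isMonoidMorphism.Build rat K (@ratr K) rM.
pose f : {rmorphism rat -> K} := HB.pack (@ratr K) a m.
by exists f.
Qed.

End RationalEmbedding.

(** * Splitting polynomials with coefficients in a given set *)

Section PolySplitting.
Context {K : fieldType}.

(** Horner's scheme: the coefficients of the quotient satisfy a recurrence descending from the top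
    degree, made of sums and products only. *)
Lemma factor_over (S : set K) (P : {poly K}) (c : K) :
  S 0 -> (forall x y, S x -> S y -> S (x + y)) ->
  (forall x y, S x -> S y -> S (x * y)) ->
  (forall i, S P`_i) -> S c -> root P c ->
  exists P1, P = P1 * ('X - c%:P) /\ forall i, S P1`_i.
Proof.
move=> S0 SD SM SP Sc /factor_theorem [P1 eP]; exists P1; split=> // i.
have rec k : P1`_k = P`_k.+1 + c * P1`_k.+1.
  by rewrite eP mulrBr coefB coefMX coefMC /= mulrC; ring.
have [n le_n] := ubnP (size P1 - i)%N; elim: n i le_n => // n IH i le_n.
have [le_i|lt_i] := leqP (size P1) i; first by rewrite nth_default.
rewrite rec; apply: SD => //; apply: SM => //; apply: IH; lia.
Qed.

(** The set [S] is a parameter because the lemma serves twice: for [Qbar], and in [Cp_split] with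
    [S] the whole field. *)
Lemma split_over (S : set K) (P : {poly K}) :
  S 0 -> (forall x y, S x -> S y -> S (x + y)) ->
  (forall x y, S x -> S y -> S (x * y)) ->
  (forall P : {poly K}, (1 < size P)%N -> (forall i, S P`_i) ->
     exists2 x, S x & root P x) ->
  P != 0 -> (forall i, S P`_i) ->
  exists2 rs : seq K, (forall x, x \in rs -> S x) &
    P = lead_coef P *: \prod_(c <- rs) ('X - c%:P).
Proof.
move=> S0 SD SM Sroot; have [n le_n] := ubnP (size P).
elim: n P le_n => // n IH P le_n P0 SP.
have [sP|sP] := leqP (size P) 1.
  exists [::] => //; rewrite big_nil alg_polyC.
  have [c ->] : exists c, P = c%:P by exists P`_0; apply: size1_polyC.
  by rewrite lead_coefC.
have [c Sc Pc] := Sroot P sP SP.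
have [P1 [eP SP1]] := factor_over S0 SD SM SP Sc Pc.
have P10 : P1 != 0 by apply: contraNneq P0 => h; rewrite eP h mul0r.
have lP : lead_coef P = lead_coef P1 by rewrite eP lead_coef_Mmonic // monicXsubC.
have lt_n : (size P1 < n)%N.
  by move: le_n; rewrite eP size_Mmonic ?monicXsubC // size_XsubC addn2 ltnS.
have [rs Srs eP1] := IH P1 lt_n P10 SP1.
exists (c :: rs) => [x|].
  by rewrite inE => /predU1P[->//|]; apply: Srs.
by rewrite big_cons lP scalerAr -eP1 mulrC.
Qed.

End PolySplitting.

Lemma prod_lt_exp (R : realDomainType) (I : eqType) (rs : seq I) (F : I -> R) (e : R) :
  0 <= e -> \prod_(c <- rs) F c < e ^+ size rs -> exists2 c, c \in rs & F c < e.
Proof.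
move=> e0 h; have [/hasP[c crs hc]|/hasPn no] := boolP (has (fun c => F c < e) rs).
  by exists c.
move: h; apply: contraTP => _; rewrite -leNgt.
elim: rs no => [|c rs IH] no; first by rewrite big_nil.
rewrite big_cons exprS ler_pM ?exprn_ge0 //.
  by rewrite leNgt no // mem_head.
by apply: IH => x xrs; apply: no; rewrite inE xrs orbT.
Qed.

(** * Integers in [K], algebraic numbers, and approximate roots *)

Section CpClosed.
Context {R : realType} {K : fieldType}.
Variables (v : K -> R) (p : nat).
Hypotheses (p_prime : prime p) (K_Cp : is_Cp v p).

Let v_abs : ultrametric_abs v := Cp_abs K_Cp.

Lemma vp_gt0 : 0 < v p%:R.
Proof. by rewrite (Cp_abs_p K_Cp) invr_gt0 ltr0n prime_gt0. Qed.

Lemma vp_lt1 : v p%:R < 1.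
Proof.
by rewrite (Cp_abs_p K_Cp) invf_lt1 ?ltr0n ?prime_gt0 // ltr1n prime_gt1.
Qed.

Lemma v_multp n : (p %| n)%N -> v n%:R < 1.
Proof.
case/dvdnP=> m ->; rewrite natrM vM // (le_lt_trans _ vp_lt1) //.
by rewrite ler_piMl ?v_ge0 ?v_nat.
Qed.

(** Bezout writes [1] as a difference of a multiple of [p] and a multiple of [m]; both cannot have
    absolute value below 1. *)
Lemma v_coprime m : coprime p m -> v m%:R = 1.
Proof.
move=> cop; apply/eqP; rewrite eq_le v_nat //= leNgt; apply/negP => lt_m.
have [u w h _] := egcdnP m (prime_gt0 p_prime); rewrite (eqP cop) in h.
have lt1 : v (u * p)%:R < 1 by rewrite v_multp // dvdn_mull.
have lt2 : v (w * m)%:R < 1.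
  by rewrite natrM vM // (le_lt_trans _ lt_m) // ler_piMl ?v_ge0 ?v_nat.
have : v 1 < 1.
  have -> : 1 = (u * p)%:R - (w * m)%:R :> K by rewrite h natrD addrC addKr.
  exact: vB_lt.
by rewrite v1 // ltxx.
Qed.

Lemma Cp_natr_neq0 n : (n.+1%:R : K) != 0.
Proof.
have [m cop ->] := pfactor_coprime p_prime (ltn0Sn n).
rewrite -(v_eq0 v_abs) natrM natrX vM // vX // v_coprime // mul1r expf_neq0 //.
by rewrite gt_eqF // vp_gt0.
Qed.

Lemma Cp_pnatr_neq0 n : (0 < n)%N -> (n%:R : K) != 0.
Proof. by case: n => // n _; apply: Cp_natr_neq0. Qed.

(* Over the rationals, unlike over [Qp], the library's [algebraicOver] applies,
   and clearing denominators gives integer polynomials to reduce modulo [p]. *)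
Definition Qbar : set K := [set x | algebraicOver (@ratr K) x].

(** Numbers algebraic over the rationals lie in [Qp_alg], so [Cp_alg_closed] provides a root; being
    integral over algebraic numbers, that root is algebraic over the rationals. *)
Lemma Qbar_closed :
  [/\ Qbar 0, (forall x y, Qbar x -> Qbar y -> Qbar (x + y)),
      (forall x y, Qbar x -> Qbar y -> Qbar (x * y)) &
      forall P : {poly K}, (1 < size P)%N -> (forall i, Qbar P`_i) ->
        exists2 x, Qbar x & root P x].
Proof.
have [f ef] := ratr_rmorph Cp_natr_neq0; rewrite /Qbar -ef.
split=> [|x y|x y|P sP PQ].
- exact: algebraic0.
- exact: algebraic_add.
- exact: algebraic_mul.
have [|x _ Px] := Cp_alg_closed K_Cp sP.
  move=> i; have [q q0 qr] := PQ i; exists (map_poly f q).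
  split=> //; first by rewrite map_poly_eq0.
  move=> j e e0; exists (ratr q`_j); first by exists q`_j.
  by rewrite coef_map /= ef subrr v0.
exists x => //; apply/integral_algebraic; apply: (@integral_root _ _ f P) => //.
  by rewrite -size_poly_gt0 ltnW.
by move=> y /(nthP 0)[i _ <-]; apply/integral_algebraic; apply: PQ.
Qed.

(* [Q] is close to a polynomial over [Qbar], which splits; the product of the
   distances from [x] to its roots is small, hence so is one of them. *)
Lemma near_root (Q : {poly K}) (x : K) (e e' : R) :
  Q != 0 -> (forall i, closure_abs v Qbar Q`_i) -> 0 < e -> 0 < e' ->
  v Q.[x] < v (lead_coef Q) * e ^+ (size Q).-1 ->
  exists2 y, Qbar y & v (x - y) < e /\ v Q.[y] < e'.
Proof.
move=> Q0 QS e0 e'0 hx; set d := (size Q).-1 in hx *; set l := lead_coef Q in hx *.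
have sQ : size Q = d.+1 by rewrite prednK ?size_poly_gt0.
have l0 : 0 < v l by rewrite v_gt0 // lead_coef_eq0.
(* [B] bounds [x] and every point within [e] of it, in particular the root found at the end. *)
pose B := Num.max 1 (Num.max (v x) e).
have B1 : 1 <= B by rewrite le_max lexx.
have xB : v x <= B by rewrite !le_max lexx orbT.
have eB : e <= B by rewrite !le_max lexx !orbT.
have B0 : 0 < B by apply: lt_le_trans B1.
have Bd : 0 < B ^+ d by rewrite exprn_gt0.
(* In this order, the three bounds preserve the absolute value of the leading coefficient, keep
   [P.[x]] under the threshold, and give [v Q.[c] < e'] at the root [c]. *)
pose del := Num.min (v l) (Num.min (v l * e ^+ d / B ^+ d) (e' / B ^+ d)).
have del0 : 0 < del.
  by rewrite !lt_min l0 /= !divr_gt0 ?mulr_gt0 ?exprn_gt0.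
have [q qQ qd] : exists2 q : nat -> K, (forall i, Qbar (q i)) &
    forall i, v (Q`_i - q i) < del.
  have [q hq] := choice (fun i => let: ex_intro2 y Sy hy := QS i del del0 in
                          ex_intro (fun y => Qbar y /\ v (Q`_i - y) < del) y (conj Sy hy)).
  by exists q => i; have [] := hq i.
have [S0 SD SM Sroot] := Qbar_closed.
pose P := \poly_(i < d.+1) q i.
have cP i : v (Q - P)`_i < del.
  rewrite coefB coef_poly; case: ltnP => // hi.
  by rewrite nth_default ?sQ // subrr v0.
have vqd : v (q d) = v l.
  have -> : l = Q`_d by [].
  apply: (v_eq_near v_abs); rewrite vBC //; apply: lt_le_trans (qd d) _.
  by rewrite ge_min lexx.
have qd0 : q d != 0 by rewrite -(v_gt0 v_abs) vqd.
have lP : lead_coef P = q d by rewrite lead_coef_poly.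
have sP : size P = d.+1 by rewrite size_poly_eq.
have P0 : P != 0 by rewrite -lead_coef_eq0 lP.
have [i|rs Srs eP] := split_over S0 SD SM Sroot P0.
  by rewrite coef_poly; case: ifP.
have srs : size rs = d.
  have := sP; rewrite {1}eP size_scale ?lead_coef_eq0 //.
  by rewrite size_prod_XsubC => -[].
have close y : v y <= B -> v (Q.[y] - P.[y]) < del * B ^+ d.
  move=> yB; rewrite -hornerN -hornerD.
  by apply: horner_close => //; rewrite (leq_trans (size_polyD _ _)) // size_polyN sP sQ maxnn.
have hPx : v P.[x] < v l * e ^+ d.
  have -> : P.[x] = Q.[x] - (Q.[x] - P.[x]) by ring.
  apply: vB_lt => //; apply: lt_le_trans (close x xB) _.
  by rewrite -ler_pdivlMr // !ge_min lexx !orbT.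
have : \prod_(c <- rs) v (x - c) < e ^+ d.
  move: hPx; rewrite eP hornerZ vM // lP vqd ltr_pM2l // horner_prod v_prod //.
  by under eq_bigr do rewrite hornerXsubC.
rewrite -srs => hprod.
have [c crs hc] : exists2 c, c \in rs & v (x - c) < e.
  exact: prod_lt_exp (ltW e0) hprod.
exists c; first exact: Srs.
split=> //.
have cB : v c <= B.
  rewrite -(subKr x c); apply: vB_le => //; exact: le_trans (ltW hc) eB.
have Pc0 : P.[c] = 0.
  apply/rootP; rewrite eP rootZ ?lead_coef_eq0 //.
  by rewrite root_prod_XsubC.
rewrite -(subr0 Q.[c]) -Pc0; apply: lt_le_trans (close c cB) _.
by rewrite -ler_pdivlMr // !ge_min lexx !orbT.
Qed.

End CpClosed.

(** * The field [K] is algebraically closed *)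

Section CpAlgClosed.
Context {R : realType} {K : fieldType}.
Variables (v : K -> R) (p : nat).
Hypotheses (p_prime : prime p) (K_Cp : is_Cp v p).

Let v_abs : ultrametric_abs v := Cp_abs K_Cp.

(** Elements of [Qp] are limits of rationals, so [near_root] applies at a root of a polynomial over
    [Qp] and puts a point of [Qbar] next to it; and [Qp_alg] is dense. *)
Lemma Qbar_dense x : closure_abs v Qbar x.
Proof.
have dense_alg t : Qp_alg v t -> closure_abs v Qbar t.
  move=> [P [P0 PQ Pt]] e e0.
  have hP i : closure_abs v Qbar P`_i.
    move=> d d0; have [_ [q _ <-] hq] := PQ i d d0; exists (ratr q) => //.
    have [f ef] := ratr_rmorph (Cp_natr_neq0 p_prime K_Cp).
    by rewrite /Qbar /= -ef; apply: algebraic_id.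
  have ht : v P.[t] < v (lead_coef P) * e ^+ (size P).-1.
    by rewrite (rootP Pt) v0 // mulr_gt0 ?exprn_gt0 // v_gt0 // lead_coef_eq0.
  have [y yQ [hy _]] := near_root p_prime K_Cp P0 hP e0 ltr01 ht.
  by exists y.
move=> e e0; have : closure_abs v (Qp_alg v) x by rewrite (Cp_alg_dense K_Cp).
move=> /(_ e e0) [t tQ ht]; have [y yQ hy] := dense_alg t tQ e e0.
by exists y => //; apply: (v_dist_lt v_abs) ht hy.
Qed.

(** By the ultrametric inequality a difference of two terms is bounded by the largest step between
    them. *)
Lemma cauchy_of_steps (u : nat -> K) (E : R) : 0 < E ->
  (forall n, v (u n - u n.+1) < E * 2^-1 ^+ n) -> cauchy_seq_abs v u.
Proof.
move=> E0 hu e e0.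
have [|n0 hn0] := @expr_lt_eps R 2^-1 (e / E) _ (divr_gt0 e0 E0).
  by rewrite invr_ge0 ler0n /= invf_lt1 // ltr1n.
have far k : v (u n0 - u (n0 + k)%N) < E * 2^-1 ^+ n0.
  elim: k => [|k IH].
    by rewrite addn0 subrr v0 // mulr_gt0 // exprn_gt0 // invr_gt0.
  apply: (v_dist_lt v_abs) IH _; rewrite addnS; apply: lt_le_trans (hu _) _.
  rewrite ler_pM2l // exprD ler_piMr ?exprn_ge0 ?invr_ge0 //.
  by rewrite exprn_ile1 ?invr_ge0 // invf_le1 // ler1n.
exists n0 => m n hm hn.
have he : E * 2^-1 ^+ n0 < e by rewrite mulrC -ltr_pdivlMr.
apply: lt_trans he; apply: (v_dist_lt v_abs (y := u n0)).
  by rewrite vBC // -(subnKC hm).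
by rewrite -(subnKC hn).
Qed.

Lemma horner_cvg (Q : {poly K}) (u : nat -> K) x :
  cvg_abs v u x -> cvg_abs v (fun n => Q.[u n]) Q.[x].
Proof.
move=> hu e e0.
have /factor_theorem [S eS] : root (Q - Q.[x]%:P) x.
  by rewrite rootE hornerD hornerN hornerC subrr.
have diff y : Q.[y] - Q.[x] = S.[y] * (y - x).
  by have := congr1 (horner^~ y) eS; rewrite hornerM hornerXsubC !hornerE.
pose B := Num.max 1 (v x).
have B1 : 1 <= B by rewrite le_max lexx.
have B0 : 0 < B by apply: lt_le_trans B1.
pose C := \sum_(i < size S) v S`_i + 1.
have C0 : 0 < C by rewrite ltr_wpDl // sumr_ge0 // => i _; rewrite v_ge0.
have SC i : v S`_i < C.
  have [hi|hi] := leqP (size S) i; first by rewrite nth_default ?v0.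
  apply: (@le_lt_trans _ _ (\sum_(i < size S) v S`_i)); last by rewrite ltrDl.
  rewrite (bigD1 (Ordinal hi)) //= lerDl.
  by apply: sumr_ge0 => j _; rewrite v_ge0.
have CB : 0 < C * B ^+ size S by rewrite mulr_gt0 // exprn_gt0.
have [|N hN] := hu (Num.min 1 (e / (C * B ^+ size S))).
  by rewrite lt_min ltr01 divr_gt0.
exists N => n /hN; rewrite lt_min => /andP[h1 h2].
have uB : v (u n) <= B.
  rewrite -(subrK x (u n)); apply: vD_le => //; last by rewrite le_max lexx orbT.
  by rewrite (le_trans (ltW h1)).
rewrite diff vM //; move: h2; rewrite ltr_pdivlMr // mulrC; apply: le_lt_trans.
rewrite ler_wpM2r ?v_ge0 // ltW // horner_close //.
Qed.

(* Each point of the sequence is a root, near the previous one, of a better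
   approximation of [Q] over [Qbar]. *)
Lemma Cp_root (Q : {poly K}) : (1 < size Q)%N -> exists x, root Q x.
Proof.
move=> sQ; have Q0 : Q != 0 by rewrite -size_poly_gt0 ltnW.
set d := (size Q).-1; have d0 : (0 < d)%N by rewrite /d; case: (size Q) sQ => [|[]].
set l := lead_coef Q; have l0 : 0 < v l by rewrite v_gt0 // lead_coef_eq0.
(* Chosen so that the starting point [0] satisfies the invariant: [v Q.[0] / v l < E <= E ^+ d]. *)
pose E := 1 + v Q.[0] / v l.
have E1 : 1 <= E by rewrite lerDl divr_ge0 ?v_ge0.
have E0 : 0 < E by apply: lt_le_trans E1.
pose r n := E * 2^-1 ^+ n.
have r0 n : 0 < r n by rewrite mulr_gt0 ?exprn_gt0 ?invr_gt0.
(* The threshold is a premise inside the existential, so that choice gives a total function; where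
   it fails, [0] is a dummy value. *)
have step (z : nat * K) : exists y, v Q.[z.2] < v l * r z.1 ^+ d ->
    v (z.2 - y) < r z.1 /\ v Q.[y] < v l * r z.1.+1 ^+ d.
  have [h|h] := pselect (v Q.[z.2] < v l * r z.1 ^+ d); last by exists 0.
  have e'0 : 0 < v l * r z.1.+1 ^+ d by rewrite mulr_gt0 ?exprn_gt0.
  have [y _ hy] := near_root p_prime K_Cp Q0 (fun i => @Qbar_dense Q`_i) (r0 z.1) e'0 h.
  by exists y.
have [g hg] := choice step.
pose s := fix s n := if n is n'.+1 then g (n', s n') else 0.
have inv n : v Q.[s n] < v l * r n ^+ d.
  elim: n => [|n IH]; last by have [] := hg (n, s n) IH.
  rewrite /= mulrC -ltr_pdivrMr // /r expr0 mulr1.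
  apply: (@lt_le_trans _ _ E); first by rewrite /E ltrDr.
  by rewrite ler_eXnr.
have [x sx] : exists x, cvg_abs v s x.
  apply: (Cp_complete K_Cp); apply: (cauchy_of_steps E0) => n.
  by have [] := hg (n, s n) (inv n).
exists x; apply/rootP; apply: (cvg_abs_unique v_abs (horner_cvg Q sx)) => e e0.
have [||n0 hn0] := @expr_lt_eps R 2^-1 (e / (v l * E ^+ d)).
- by rewrite invr_ge0 ler0n /= invf_lt1 // ltr1n.
- by rewrite divr_gt0 // mulr_gt0 // exprn_gt0.
exists n0 => n hn; rewrite subr0; apply: lt_le_trans (inv n) _.
rewrite ltr_pdivlMr ?mulr_gt0 ?exprn_gt0 // in hn0; apply: le_trans (ltW hn0).
rewrite exprMn mulrA [leRHS]mulrC ler_pM2l ?mulr_gt0 ?exprn_gt0 //.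
rewrite -exprM ler_wiXn2l ?invr_ge0 ?invf_le1 ?ler1n //.
by rewrite (leq_trans hn) // leq_pmulr.
Qed.

Lemma Cp_split (P : {poly K}) : P != 0 ->
  exists rs : seq K, P = lead_coef P *: \prod_(c <- rs) ('X - c%:P).
Proof.
move=> P0; have [|||Q sQ _|//||rs _ h] := @split_over K setT P; last by exists rs.
all: try by [].
by have [x Qx] := Cp_root sQ; exists x.
Qed.

(** In characteristic zero ['X^m - 1] is separable, so it has [m] distinct roots, and a group of
    that many roots of unity contains a primitive one. *)
Lemma Cp_prim_root m : (0 < m)%N -> exists w : K, m.-primitive_root w.
Proof.
move=> m0; have P0 : ('X^m - 1 : {poly K}) != 0.
  by rewrite -size_poly_gt0 size_XnsubC.
have [rs eP] := Cp_split P0.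
rewrite (monicP (monicXnsubC _ _)) // scale1r in eP.
have srs : size rs = m by have := size_XnsubC (1 : K) m0; rewrite eP size_prod_XsubC => -[].
have : uniq rs.
  by rewrite -separable_prod_XsubC -eP separable_Xn_sub_1 // (Cp_pnatr_neq0 p_prime K_Cp).
move=> urs; have /hasP[w _ hw] : has m.-primitive_root rs.
  apply: has_prim_root => //; last by rewrite srs.
  apply/allP => x xrs; rewrite unity_rootE -subr_eq0.
  have /rootP : root ('X^m - 1) x by rewrite eP root_prod_XsubC.
  by rewrite !hornerE => ->.
by exists w.
Qed.

End CpAlgClosed.

(** * Residues and Teichmuller representatives *)

Section Teichmuller.
Context {R : realType} {K : fieldType}.
Variables (v : K -> R) (p : nat).
Hypotheses (p_prime : prime p) (K_Cp : is_Cp v p).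

Let v_abs : ultrametric_abs v := Cp_abs K_Cp.

Lemma vX_diff x y k : v x <= 1 -> v y <= 1 -> v (x ^+ k - y ^+ k) <= v (x - y).
Proof.
move=> hx hy; rewrite subrXX vM // ler_piMr ?v_ge0 //.
by apply: v_sum_le => // i _; rewrite vM // mulr_ile1 ?v_ge0 ?vX_le1.
Qed.

(** The cofactor of [x - y] in [x ^+ p - y ^+ p] is congruent to [p%:R * y ^+ p.-1] modulo
    [x - y]. *)
Lemma v_pow_diff x y : v x <= 1 -> v y <= 1 ->
  v (x ^+ p - y ^+ p) <= v (x - y) * Num.max (v p%:R) (v (x - y)).
Proof.
move=> hx hy; rewrite subrXX vM // ler_wpM2l ?v_ge0 //.
have -> : \sum_(i < p) x ^+ (p.-1 - i) * y ^+ i =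
    \sum_(i < p) (x ^+ (p.-1 - i) - y ^+ (p.-1 - i)) * y ^+ i + p%:R * y ^+ p.-1.
  have -> : p%:R * y ^+ p.-1 = \sum_(i < p) y ^+ p.-1.
    by rewrite sumr_const card_ord mulr_natl.
  rewrite -big_split /=; apply: eq_bigr => i _.
  rewrite mulrBl -exprD subnK ?subrK //; have := ltn_ord i; lia.
have mp : 0 <= Num.max (v p%:R) (v (x - y)) by rewrite le_max v_ge0.
apply: vD_le => //.
  apply: v_sum_le => // i _; rewrite mulrC vM_le ?vX_le1 //.
  by rewrite (le_trans (vX_diff _ hx hy)) // le_max lexx orbT.
by rewrite mulrC vM_le ?vX_le1 // le_max lexx.
Qed.

(** Each further p-th power gains a factor [c]. *)
Lemma v_iter_pow_diff x y c n : v x <= 1 -> v y <= 1 -> v p%:R <= c -> c <= 1 ->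
  v (x - y) <= c -> v (x ^+ (p ^ n) - y ^+ (p ^ n)) <= c ^+ n.+1.
Proof.
move=> hx hy pc c1 hc; elim: n => [|n IH]; first by rewrite !expr1.
have c0 : 0 <= c by apply: le_trans pc; rewrite v_ge0.
rewrite expnSr !exprM (le_trans (v_pow_diff _ _)) ?vX_le1 //.
rewrite [leRHS]exprSr ler_pM ?(v_ge0 v_abs) ?le_max ?(v_ge0 v_abs) //.
rewrite ge_max pc /=.
by rewrite (le_trans IH) // exprS ler_piMr // exprn_ile1.
Qed.

(** With [y] the Teichmuller representative of [x], this trades the powers of [x] for powers that
    are constant along a suitable [N]. *)
Lemma cvg_iter_pow x y (N : nat -> nat) : v x <= 1 -> v y <= 1 -> v (x - y) < 1 ->
  (forall k, (k <= N k)%N) ->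
  cvg_abs v (fun k => x ^+ (p ^ N k) - y ^+ (p ^ N k)) 0.
Proof.
move=> hx hy hxy hN e e0; pose c := Num.max (v p%:R) (v (x - y)).
have c0 : 0 <= c by rewrite le_max v_ge0.
have c1 : c < 1 by rewrite gt_max (vp_lt1 p_prime K_Cp).
have [|n0 hn0] := @expr_lt_eps R c e _ e0; first by rewrite c0.
exists n0 => n hn; rewrite subr0; apply: le_lt_trans hn0.
apply: (le_trans (v_iter_pow_diff (c := c) _ hx hy _ (ltW c1) _)).
- by rewrite le_max lexx.
- by rewrite le_max lexx orbT.
rewrite ler_wiXn2l // ?(ltW c1) //; have := hN n; lia.
Qed.

Lemma v_frobenius x y : v x <= 1 -> v y <= 1 ->
  v ((x + y) ^+ p - (x ^+ p + y ^+ p)) < 1.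
Proof.
move=> hx hy; have := p_prime; case: p p_prime (@v_multp _ _ _ _ p_prime K_Cp) => // q qp mulq _.
rewrite exprDn big_ord_recl big_ord_recr /= !subn0 subnn bin0 binn !expr0 !mulr1 mul1r !mulr1n.
rewrite [X in v X](_ : _ = \sum_(i < q) x ^+ (q.+1 - bump 0 i) * y ^+ bump 0 i *+ 'C(q.+1, bump 0 i)); last by ring.
apply: v_sum_lt => // i _; rewrite -mulr_natr vM //.
apply: (@le_lt_trans _ _ (v ('C(q.+1, bump 0 i)%:R : K))).
  rewrite ler_piMl ?v_ge0 // vM // mulr_ile1 ?v_ge0 ?vX_le1 //.
by apply: mulq; rewrite prime_dvd_bin //= /bump add1n ltnS ltn_ord.
Qed.

(** Frobenius is injective on the residue field: there [(w - 1) ^+ p] and [w ^+ p - 1] agree. *)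
Lemma v_sub1_iter u n : v u <= 1 -> v (u ^+ (p ^ n) - 1) < 1 -> v (u - 1) < 1.
Proof.
move=> hu; elim: n => [|n IH]; first by rewrite expr1.
rewrite expnSr exprM => h; apply: IH; set w := u ^+ _ in h *.
have hw : v w <= 1 by apply: vX_le1.
have : v ((w - 1) ^+ p) < 1.
  have := v_frobenius (x := w - 1) (y := 1).
  rewrite subrK v1 // expr1n => /(_ _ (lexx 1)) h2.
  have -> : (w - 1) ^+ p = (w ^+ p - 1) - (w ^+ p - ((w - 1) ^+ p + 1)) by ring.
  apply: vB_lt => //; apply: h2; apply: vB_le => //; by rewrite v1.
by rewrite vX // expr_lt1 ?prime_gt0 ?v_ge0.
Qed.

(** This makes the residue of [u] algebraic over ['F_p]. Some [t] in [Qbar] has the same residue; a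
    primitive integer polynomial vanishing at [t] is small at [u], and having content 1 it survives
    modulo [p]. *)
Lemma residue_int_relation u : v u = 1 ->
  exists G : {poly int}, v (map_poly intr G).[u] < 1 /\
    map_poly intr G != 0 :> {poly 'F_p}.
Proof.
move=> u1; have [t [q q0 qt] hut] := Qbar_dense p_prime K_Cp u ltr01.
have [z [a a0 eq]] := rat_poly_scale q; pose G := zprimitive z.
have z0 : z != 0 by apply: contraNneq q0 => z0; rewrite eq z0 map_poly0 scaler0.
exists G; split; last first.
  apply/eqP => G0; have : (p%:Z %| zcontents G)%Z.
    rewrite dvdz_contents; apply/polyOverP => i.
    rewrite (dvdz_pcharf (pchar_Fp p_prime)) /=.
    by have := congr1 (fun P : {poly _} => P`_i) G0; rewrite coef_map coef0 => ->.
  rewrite zcontents_primitive z0 dvdz1 /= => /eqP p1.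
  by have := prime_gt1 p_prime; rewrite p1.
have [f ef] := ratr_rmorph (Cp_natr_neq0 p_prime K_Cp).
have Gt : (map_poly intr G).[t] = 0 :> K.
  have cz0 : zcontents z != 0 by rewrite zcontents_eq0.
  have := rootP qt; rewrite eq (zpolyEprim z) -ef linearZ /=.
  rewrite map_polyZ /= map_polyZ /= -/G scalerA hornerZ.
  move/eqP; rewrite mulf_eq0 -rmorphM fmorph_eq0 mulf_eq0 invr_eq0 !intr_eq0.
  rewrite (negPf a0) (negPf cz0) /= -map_poly_comp => /eqP <-; congr (_.[_]).
  by apply: eq_map_poly => x /=; rewrite rmorph_int.
have t1 : v t = 1 by rewrite -u1; apply: (v_eq_near v_abs); rewrite vBC // u1.
rewrite -(subr0 (_.[u])) -Gt !horner_coef -sumrB; apply: v_sum_lt => // i _.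
rewrite -mulrBr coef_map /=; apply: le_lt_trans hut.
by rewrite vM_le ?v_int // vX_diff // ?u1 ?t1.
Qed.

(* The powers of ['X] take finitely many values modulo [G] in ['F_p[X]], so two
   powers of [u] have the same residue. *)
Lemma residue_order u : v u = 1 ->
  exists2 m, (0 < m)%N && coprime p m & v (u ^+ m - 1) < 1.
Proof.
(* Any positive exponent will do: its p-part is removed by [v_sub1_iter]. *)
move=> u1; suff [k k0 hk] : exists2 k, (0 < k)%N & v (u ^+ k - 1) < 1.
  have [m cop ek] := pfactor_coprime p_prime k0; exists m.
    by rewrite cop andbT; move: k0; rewrite ek muln_gt0 => /andP[].
  rewrite ek exprM in hk; apply: v_sub1_iter hk.
  by rewrite vX_le1 // u1.
have [G [Gu G0]] := residue_int_relation u1.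
set Gp := map_poly intr G in G0.
pose ev (P : {poly int}) : K := (map_poly intr P).[u].
have evB P Q : ev (P - Q) = ev P - ev Q by rewrite /ev rmorphB hornerD hornerN.
have evM P Q : ev (P * Q) = ev P * ev Q by rewrite /ev rmorphM hornerM.
have ev_le1 P : v (ev P) <= 1.
  rewrite /ev horner_coef; apply: v_sum_le => // i _.
  by rewrite coef_map /= vM_le ?v_int // vX_le1 // u1.
have ev_lt1 P : map_poly intr P = 0 :> {poly 'F_p} -> v (ev P) < 1.
  move=> P0; rewrite /ev horner_coef; apply: v_sum_lt => // i _.
  rewrite mulrC coef_map /=; apply: (@le_lt_trans _ _ (v ((P`_i)%:~R : K))).
    by rewrite vM_le // vX_le1 // u1.
  have : (p%:Z %| P`_i)%Z.
    rewrite (dvdz_pcharf (pchar_Fp p_prime)) /=.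
    by have := congr1 (fun P : {poly _} => P`_i) P0; rewrite coef_map coef0 => ->.
  move=> /dvdzP[q ->]; rewrite intrM vM //.
  rewrite (le_lt_trans _ (vp_lt1 p_prime K_Cp)) // ler_piMl ?v_ge0 ?v_int //.
pose L (P : {poly 'F_p}) : {poly int} := map_poly (fun x : 'F_p => (x : nat)%:Z) P.
have LK P : map_poly intr (L P) = P.
  apply/polyP => i; rewrite coef_map /= coef_map_id0 //.
  exact: natr_Zp.
pose r i : {poly 'F_p} := 'X^i %% Gp.
(* The residue of [u ^+ i] depends only on the remainder [r i]: the rest is a multiple of [G] plus a
   polynomial divisible by [p]. *)
have ur i : v (u ^+ i - ev (L (r i))) < 1.
  have -> : u ^+ i - ev (L (r i)) =
     ev ('X^i - L ('X^i %/ Gp) * G - L (r i)) + ev (L ('X^i %/ Gp)) * ev G.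
    rewrite !evB evM; have -> : ev 'X^i = u ^+ i by rewrite /ev map_polyXn hornerXn.
    by ring.
  apply: vD_lt => //; last by rewrite (le_lt_trans _ Gu) // vM_le.
  apply: ev_lt1; rewrite !rmorphB rmorphM /= !LK map_polyXn -/Gp.
  by apply/eqP; rewrite subr_eq0 subr_eq addrC -divp_eq.
pose T := {ffun 'I_(size Gp) -> 'F_p}.
pose h (i : 'I_(#|T|.+1)) : T := [ffun j : 'I_(size Gp) => (r i)`_j].
have /injectivePn[i [j ij hij]] : ~~ injectiveb h.
  apply/negP => /injectiveP /leq_card; rewrite card_ord.
  by rewrite ltnn.
have rij : r i = r j.
  apply/polyP => k; have sz l : (size (r l) <= size Gp)%N by rewrite ltnW // ltn_modp.
  have [hk|hk] := leqP (size Gp) k; first by rewrite !nth_default // (leq_trans (sz _)).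
  by have := congr1 (fun f : T => f (Ordinal hk)) hij; rewrite !ffunE.
have uij : v (u ^+ i - u ^+ j) < 1.
  by apply: (v_dist_lt v_abs (ur i)); rewrite vBC // rij.
wlog lt_ij : i j ij uij {hij rij} / (i < j)%N => [wl|].
  have [lt|lt|eq] := ltngtP i j; first exact: (wl i j).
    by apply: (wl j i) => //; rewrite 1?eq_sym // vBC.
  by case/eqP: ij; apply: val_inj.
exists (j - i)%N; first by rewrite subn_gt0.
move: uij; rewrite -{1}(subnKC (ltnW lt_ij)) exprD vBC // -[X in _ - X]mulr1 -mulrBr.
by rewrite vM // vX // u1 expr1n mul1r.
Qed.

Definition root_of_unity (w : K) := exists2 m, coprime p m & m.-primitive_root w.

(** For a suitable [m], the value [u ^+ m - 1] is small, and it is the product of the [u - z ^+ i]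
    over the m-th roots of unity, so one factor is small. *)
Lemma near_root_of_unity u : v u = 1 -> exists2 w, root_of_unity w & v (u - w) < 1.
Proof.
move=> u1; have [m /andP[m0 cop] hm] := residue_order u1.
have [z zm] := Cp_prim_root p_prime K_Cp m0.
have : \prod_(0 <= i < m) v (u - z ^+ i) < 1 ^+ size (index_iota 0 m).
  have := congr1 (horner^~ u) (factor_Xn_sub_1 zm).
  rewrite horner_prod !hornerE expr1n => e; move: hm; rewrite -e v_prod //.
  by under eq_bigr do rewrite hornerXsubC.
move=> /(prod_lt_exp ler01) [i _ hi]; exists (z ^+ i) => //.
have zi : (z ^+ i) ^+ m = 1 by rewrite exprAC (prim_expr_order zm) expr1n.
have [m' m'z dv] := prim_order_exists m0 zi; exists m' => //.
exact: coprime_dvdr dv cop.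
Qed.

Lemma teich_spec x : v x <= 1 -> let w := teichmuller v p x in
  v (x - w) < 1 /\ if v x == 1 then root_of_unity w else w = 0.
Proof.
move=> x1 /=; rewrite /teichmuller; case: ifP => [/eqP e|ne]; last first.
  by split=> //; rewrite subr0 lt_neqAle ne.
have [w hw hxw] := near_root_of_unity e.
have [h1 h2] := @xgetPex K 0 [set w | root_of_unity w /\ v (x - w) < 1]
  (ex_intro _ w (conj hw hxw)).
by split.
Qed.

(** Euler's theorem: some positive power of [p] is 1 modulo the order. This periodicity is the
    reason for the progressions [alpha + lambda * k] in [Phi_set]. *)
Lemma root_of_unity_period w : root_of_unity w ->
  exists2 lam, (0 < lam)%N & w ^+ (p ^ lam) = w.
Proof.
move=> [m cop wm]; exists (totient m).
  by rewrite totient_gt0 (prim_order_gt0 wm).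
rewrite -(prim_expr_mod wm) (Euler_exp_totient cop) (prim_expr_mod wm).
by rewrite expr1.
Qed.

Lemma period_mul (w : K) lam k : w ^+ (p ^ lam) = w -> w ^+ (p ^ (k * lam)) = w.
Proof. by move=> h; elim: k => [|k IH]; rewrite ?expr1 // mulSn expnD exprM h. Qed.

End Teichmuller.

(** * Averages over roots of unity *)

Section UnityAverage.
Context {R : realType} {K : fieldType}.
Variables (v : K -> R) (p : nat).
Hypotheses (p_prime : prime p) (K_Cp : is_Cp v p).

Let v_abs : ultrametric_abs v := Cp_abs K_Cp.

Definition avg (N : nat) (h : K -> K) : K :=
  N%:R^-1 * \sum_(z \in [set z : K | N.-unity_root z]) h z.

(** Replaces the sum over a set by a sum over the powers of one primitive root, on which linearity
    is immediate. *)
Lemma avgE N : (0 < N)%N -> exists2 e : K, N.-primitive_root e &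
  forall h, avg N h = N%:R^-1 * \sum_(i < N) h (e ^+ i).
Proof.
move=> N0; have [e eN] := Cp_prim_root p_prime K_Cp N0; exists e => // h.
rewrite /avg; congr (_ * _).
have -> : [set z : K | N.-unity_root z] = [set` [seq e ^+ i | i : 'I_N <- enum 'I_N]].
  apply/seteqP; split=> z /=.
    move=> /unity_rootP /(prim_rootP eN)[i ->]; apply/mapP; exists i => //.
    by rewrite mem_enum.
  move=> /mapP[i _ ->]; apply/unity_rootP.
  by rewrite exprAC (prim_expr_order eN) expr1n.
rewrite -fsbig_seq; last first.
  rewrite map_inj_in_uniq ?enum_uniq // => i j _ _ /eqP.
  by rewrite (eq_prim_root_expr eN) !modn_small // => /eqP; apply: val_inj.
by rewrite big_map big_enum.
Qed.

Lemma eq_avg N h h' : (forall z, z ^+ N = 1 -> h z = h' z) -> avg N h = avg N h'.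
Proof.
move=> e; rewrite /avg; congr (_ * _); apply: eq_fsbigr => z.
by rewrite inE /= => /unity_rootP; apply: e.
Qed.

Lemma avgD N h h' : (0 < N)%N -> avg N (fun z => h z + h' z) = avg N h + avg N h'.
Proof. by move=> /avgE[e _ E]; rewrite !E big_split mulrDr. Qed.

Lemma avgZ N c h : (0 < N)%N -> avg N (fun z => c * h z) = c * avg N h.
Proof. by move=> /avgE[e _ E]; rewrite !E -mulr_sumr mulrCA. Qed.

Lemma avgB N h h' : (0 < N)%N -> avg N (fun z => h z - h' z) = avg N h - avg N h'.
Proof. by move=> /avgE[e _ E]; rewrite !E sumrB mulrBr. Qed.

Lemma avg_sum (I : Type) (r : seq I) N (h : I -> K -> K) : (0 < N)%N ->
  avg N (fun z => \sum_(i <- r) h i z) = \sum_(i <- r) avg N (h i).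
Proof.
move=> /avgE[e _ E]; rewrite E exchange_big mulr_sumr /=.
by apply: eq_bigr => i _; rewrite E.
Qed.

Lemma avg_le N h (B : R) : (0 < N)%N -> (forall z, z ^+ N = 1 -> v (h z) <= B) ->
  v (avg N h) <= v (N%:R^-1) * B.
Proof.
move=> N0 hB; have [e eN E] := avgE N0; rewrite E vM //.
have B0 : 0 <= B by apply: le_trans (hB 1 (expr1n _ _)); rewrite v_ge0.
rewrite ler_wpM2l ?v_ge0 //; apply: v_sum_le => // i _.
by rewrite hB // exprAC (prim_expr_order eN) expr1n.
Qed.

(** Orthogonality: unless [e ^+ l = 1], the geometric sum is annihilated by [e ^+ l - 1]. *)
Lemma avg_monomial N l : (0 < N)%N -> avg N (fun z => z ^+ l) = (N %| l)%:R.
Proof.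
move=> N0; have [e eN ->] := avgE N0.
have [dv|ndv] := boolP (N %| l)%N.
  have el : e ^+ l = 1 by apply/eqP; rewrite -(prim_order_dvd eN).
  rewrite (eq_bigr (fun=> 1)) => [|i _]; last by rewrite exprAC el expr1n.
  by rewrite sumr_const card_ord mulVf // (Cp_pnatr_neq0 p_prime K_Cp).
have el : e ^+ l - 1 != 0 by rewrite subr_eq0 -(prim_order_dvd eN).
have -> : \sum_(i < N) (e ^+ i) ^+ l = 0; last by rewrite mulr0.
apply: (mulfI el); rewrite mulr0 -[RHS](subrr 1).
transitivity ((e ^+ l) ^+ N - 1); last by rewrite exprAC (prim_expr_order eN) expr1n.
by rewrite [RHS]subrX1; congr (_ * _); apply: eq_bigr => i _; rewrite exprAC.
Qed.

Lemma avg_poly N (G : {poly K}) : (0 < N)%N ->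
  avg N (horner G) = \sum_(i < size G | (N %| i)%N) G`_i.
Proof.
move=> N0; transitivity (avg N (fun z => \sum_(i < size G) G`_i * z ^+ i)).
  by apply: eq_avg => z _; rewrite horner_coef.
rewrite avg_sum // [RHS]big_mkcond; apply: eq_bigr => i _.
by rewrite avgZ // avg_monomial //; case: ifP => _; rewrite ?mulr1 ?mulr0.
Qed.

(** The trivial bound for an average loses the factor [1 / N]. For polynomials only the coefficients
    at multiples of [N] survive averaging, so integrality of the coefficients bounds the average
    with no denominator. *)
Definition integral_on N (h : K -> K) := exists2 G : {poly K},
  (forall i, v G`_i <= 1) & forall z, z ^+ N = 1 -> h z = G.[z].

Lemma avg_integral_le1 N h : (0 < N)%N -> integral_on N h -> v (avg N h) <= 1.
Proof.
move=> N0 [G G1 e]; rewrite (eq_avg e) avg_poly //.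
exact: v_sum_le.
Qed.

Lemma integral_onX N : integral_on N id.
Proof.
exists 'X => [i|z _]; last by rewrite hornerX.
by rewrite coefX v_nat.
Qed.

Lemma integral_onC N c : v c <= 1 -> integral_on N (fun=> c).
Proof.
move=> c1; exists c%:P => [i|z _]; last by rewrite hornerC.
by rewrite coefC; case: ifP => // _; rewrite v0 // ler01.
Qed.

Lemma integral_onM N h h' : integral_on N h -> integral_on N h' ->
  integral_on N (fun z => h z * h' z).
Proof.
move=> [G G1 e] [G' G'1 e']; exists (G * G') => [i|z hz]; last by rewrite hornerM e ?e'.
by rewrite coefM; apply: v_sum_le => // j _; rewrite vM_le.
Qed.

Lemma integral_onD N h h' : integral_on N h -> integral_on N h' ->
  integral_on N (fun z => h z + h' z).
Proof.
move=> [G G1 e] [G' G'1 e']; exists (G + G') => [i|z hz]; last by rewrite hornerD e ?e'.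
by rewrite coefD vD_le.
Qed.

Lemma integral_on_exp N h k : integral_on N h -> integral_on N (fun z => h z ^+ k).
Proof.
move=> hh; elim: k => [|k IH]; first by apply: integral_onC; rewrite v1.
have [G G1 e] := integral_onM hh IH.
by exists G => // z hz; rewrite exprS e.
Qed.

Lemma integral_on_sum (I : Type) (r : seq I) N (h : I -> K -> K) :
  (forall i, integral_on N (h i)) -> integral_on N (fun z => \sum_(i <- r) h i z).
Proof.
move=> hh; elim: r => [|i r IH].
  have [G G1 e] : integral_on N (fun=> 0) by apply: integral_onC; rewrite v0 ?ler01.
  by exists G => // z hz; rewrite big_nil -e.
have [G G1 e] := integral_onD (hh i) IH.
by exists G => // z hz; rewrite big_cons e.
Qed.

(** Since [z ^+ N = 1], the cofactor of [z - u] in [z ^+ N - u ^+ N], divided by the unit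
    [1 - u ^+ N], is the inverse of [z - u]. *)
Lemma integral_on_inv N u : (0 < N)%N -> v u <= 1 -> v (1 - u ^+ N) = 1 ->
  integral_on N (fun z => (z - u)^-1).
Proof.
move=> N0 u1 uN; have nz : 1 - u ^+ N != 0 by rewrite -(v_eq0 v_abs) uN oner_eq0.
have : integral_on N (fun z => (1 - u ^+ N)^-1 * \sum_(i < N) z ^+ (N.-1 - i) * u ^+ i).
  apply: integral_onM; first by apply: integral_onC; rewrite vV // uN invr1.
  apply: integral_on_sum => i; apply: integral_onM.
    exact/integral_on_exp/integral_onX.
  by apply: integral_onC; rewrite vX_le1.
move=> [G G1 e]; exists G => // z hz; rewrite -e //.
have : (z - u) * \sum_(i < N) z ^+ (N.-1 - i) * u ^+ i = 1 - u ^+ N.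
  by rewrite -subrXX hz.
move=> h; have zu : z - u != 0.
  by apply: contraNneq nz => zu; rewrite -h zu mul0r.
by apply: (mulfI zu); rewrite mulfV // mulrCA h mulVf.
Qed.

Lemma integral_on_sub N u : v u <= 1 -> integral_on N (fun z => z - u).
Proof.
by move=> u1; apply: integral_onD; [apply: integral_onX|apply: integral_onC; rewrite vN].
Qed.

(** The polynomial is monic of degree [l.+1 <= N] without constant term, so only its leading
    coefficient can sit at a multiple of [N]. *)
Lemma avg_shifted_pow N u l : (l < N)%N ->
  avg N (fun z => z * (z - u) ^+ l) = (l.+1 == N)%:R.
Proof.
move=> lN; have N0 : (0 < N)%N by apply: leq_ltn_trans lN.
pose G := 'X * ('X - u%:P) ^+ l : {poly K}.
have sG : size G = l.+2.
  by rewrite /G mulrC size_mulX ?size_exp_XsubC // expf_neq0 // polyXsubC_eq0.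
have -> : avg N (fun z => z * (z - u) ^+ l) = avg N (horner G).
  by apply: eq_avg => z _; rewrite /G !hornerE.
rewrite avg_poly // sG big_mkcond big_ord_recl /= dvdn0.
have -> : G`_0 = 0 by rewrite coefXM.
rewrite add0r big_ord_recr /= big1 => [|i _]; last first.
  by case: ifP => // /dvdn_leq -/(_ isT); have := ltn_ord i; rewrite /bump /=; lia.
rewrite add0r /bump /= add1n; case: eqVneq => [<-|ne].
  rewrite dvdnn; have -> : G`_l.+1 = lead_coef G by rewrite lead_coefE sG.
  by apply/monicP; rewrite monicMl ?monicX // monic_exp // monicXsubC.
case: ifP => // /dvdn_leq -/(_ isT); lia.
Qed.

(* Expand [1 = z ^+ N = (u + (z - u)) ^+ N]; the terms with [e <= i.+1] are then
   averages of polynomials. *)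
Lemma avg_recurrence N u e : (0 < N)%N -> u ^+ N != 1 ->
  (1 - u ^+ N) * avg N (fun z => z / (z - u) ^+ e) =
  \sum_(i < N) ('C(N, i.+1)%:R * u ^+ (N - i.+1)) *
    avg N (fun z => z * ((z - u) ^+ i.+1 / (z - u) ^+ e)).
Proof.
move=> N0 uN; set A := avg N _.
have eA : avg N (fun z => z * ((z - u) ^+ 0 / (z - u) ^+ e)) = A.
  by apply: eq_avg => z _; rewrite expr0 mul1r.
have -> : (1 - u ^+ N) * A = A - u ^+ N * A by rewrite mulrBl mul1r.
have main : A = \sum_(i < N.+1) ('C(N, i)%:R * u ^+ (N - i)) *
    avg N (fun z => z * ((z - u) ^+ i / (z - u) ^+ e)).
  transitivity (avg N (fun z => \sum_(i < N.+1) ('C(N, i)%:R * u ^+ (N - i)) *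
                                (z * ((z - u) ^+ i / (z - u) ^+ e)))).
    apply: eq_avg => z hz.
    have -> : z / (z - u) ^+ e = z / (z - u) ^+ e * (u + (z - u)) ^+ N.
      by rewrite (addrC u) subrK hz mulr1.
    rewrite [(u + _) ^+ _]exprDn mulr_sumr.
    by apply: eq_bigr => i _; rewrite -mulr_natr; ring.
  by rewrite avg_sum //; apply: eq_bigr => i _; rewrite avgZ.
by rewrite {1}main big_ord_recl /= eA bin0 subn0 mul1r addrAC subrr add0r.
Qed.

(** In the recurrence with exponent 1 every average is given by [avg_shifted_pow], and only the last
    one is nonzero. *)
Lemma avg_inv N u : (0 < N)%N -> u ^+ N != 1 ->
  avg N (fun z => z / (z - u)) = (1 - u ^+ N)^-1.
Proof.
move=> N0 uN; have nz : 1 - u ^+ N != 0 by rewrite subr_eq0 eq_sym.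
apply: (mulfI nz); rewrite mulfV //.
have zu z : z ^+ N = 1 -> z - u != 0.
  by move=> hz; apply: contraNneq uN => /eqP; rewrite subr_eq0 => /eqP <-; apply/eqP.
rewrite -[X in X = _]/(_ * avg N (fun z => z / (z - u) ^+ 1)) avg_recurrence //.
case: N N0 uN nz zu => // N _ uN nz zu.
rewrite (eq_bigr (fun i : 'I_N.+1 => 'C(N.+1, i.+1)%:R * u ^+ (N.+1 - i.+1) * (i.+1 == N.+1)%:R)).
  rewrite big_ord_recr /= big1 => [|i _]; last first.
    by rewrite eqSS (ltn_eqF (ltn_ord i)) mulr0.
  by rewrite binn subnn expr0 eqxx !mulr1 add0r.
move=> i _; congr (_ * _); rewrite -(avg_shifted_pow u (ltn_ord i)).
by apply: eq_avg => z hz; rewrite exprSr expr1 mulfK ?zu.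
Qed.

(** In the recurrence, a term with [i.+1 < e.+2] has a small binomial coefficient and an integral
    average; the others average polynomials of degree below [N] without constant term, hence
    vanish. *)
Lemma avg_inv_pow_le N u e (c : R) : 0 <= c -> (0 < N)%N -> v u <= 1 ->
  v (1 - u ^+ N) = 1 ->
  (forall i, (0 < i < e.+2)%N -> v 'C(N, i)%:R <= c) ->
  v (avg N (fun z => z / (z - u) ^+ e.+2)) <= c.
Proof.
move=> c0 N0 u1 uN hC.
have nz : 1 - u ^+ N != 0 by rewrite -(v_eq0 v_abs) uN oner_eq0.
have uN1 : u ^+ N != 1 by rewrite eq_sym -subr_eq0.
have zu z : z ^+ N = 1 -> z - u != 0.
  by move=> hz; apply: contraNneq uN1 => /eqP; rewrite subr_eq0 => /eqP <-; apply/eqP.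
have := congr1 v (avg_recurrence e.+2 N0 uN1); rewrite vM // uN mul1r => ->.
apply: v_sum_le => // i _; have [hi|hi] := ltnP i.+1 e.+2.
  rewrite mulrC vM_le //; last by rewrite mulrC vM_le ?vX_le1 // hC.
  apply: avg_integral_le1 => //; apply: integral_onM; first exact: integral_onX.
  apply: integral_onM; first exact/integral_on_exp/integral_on_sub.
  have [G G1 eG] := integral_on_exp e.+2 (integral_on_inv N0 u1 uN).
  by exists G => // z hz; rewrite -exprVn eG.
have -> : avg N (fun z => z * ((z - u) ^+ i.+1 / (z - u) ^+ e.+2)) =
    avg N (fun z => z * (z - u) ^+ (i.+1 - e.+2)).
  apply: eq_avg => z hz; congr (_ * _).
  by rewrite -{1}(subnK hi) exprD mulfK // expf_neq0 // zu.
have iN := ltn_ord i.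
rewrite avg_shifted_pow; last by lia.
by rewrite (_ : _ == _ = false) ?mulr0 ?v0 //; lia.
Qed.

(** Multiplying the binomial coefficient by the fixed number [i] makes it divisible by [p ^ n k]. *)
Lemma cvg_bin (n : nat -> nat) i : (0 < i)%N -> (forall k, (k <= n k)%N) ->
  cvg_abs v (fun k => 'C(p ^ n k, i)%:R) 0.
Proof.
case: i => // i _ hn e e0; have i0 := Cp_natr_neq0 p_prime K_Cp i.
have vi : 0 < v (i.+1%:R) by rewrite (v_gt0 v_abs).
have [||n0 hn0] := @expr_lt_eps R (v p%:R) (e * v i.+1%:R).
- by rewrite v_ge0 // (vp_lt1 p_prime K_Cp).
- by rewrite mulr_gt0.
exists n0 => k hk; rewrite subr0 -(ltr_pM2r vi); apply: le_lt_trans hn0.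
have pn0 : (0 < p ^ n k)%N by rewrite expn_gt0 prime_gt0.
have -> : v 'C(p ^ n k, i.+1)%:R * v i.+1%:R = v (p ^ n k * 'C((p ^ n k).-1, i))%:R.
  by rewrite -vM // -natrM mulnC -mul_bin_diag.
rewrite natrM mulrC vM_le ?v_nat // natrX vX // ler_wiXn2l ?v_ge0 ?(ltW (vp_lt1 p_prime K_Cp)) //.
by rewrite (leq_trans hk).
Qed.

End UnityAverage.

(** * Limits of the averages of rational kernels *)

Section KernelLimit.
Context {R : realType} {K : fieldType}.
Variables (v : K -> R) (p : nat).
Hypotheses (p_prime : prime p) (K_Cp : is_Cp v p).

Let v_abs : ultrametric_abs v := Cp_abs K_Cp.

Let pn_gt0 n : (0 < p ^ n)%N.
Proof. by rewrite expn_gt0 prime_gt0. Qed.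

Lemma unit_sub_pow u n : v u <= 1 -> v (1 - u) = 1 -> v (1 - u ^+ (p ^ n)) = 1.
Proof.
move=> u1 uu; apply/eqP; rewrite eq_le; apply/andP; split.
  by apply: vB_le => //; rewrite ?v1 // vX_le1.
rewrite leNgt; apply/negP; rewrite vBC // => /(v_sub1_iter p_prime K_Cp u1).
by rewrite vBC // uu ltxx.
Qed.

Lemma pow_neq1 u n : v u <= 1 -> v (1 - u) = 1 -> u ^+ (p ^ n) != 1.
Proof.
move=> u1 /(unit_sub_pow n u1) h; rewrite eq_sym -subr_eq0 -(v_eq0 v_abs) h.
exact: oner_neq0.
Qed.

Lemma unity_sub_neq0 u n z : v u <= 1 -> v (1 - u) = 1 -> z ^+ (p ^ n) = 1 -> z - u != 0.
Proof.
move=> u1 uu hz; apply: contraNneq (pow_neq1 n u1 uu) => /eqP.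
by rewrite subr_eq0 => /eqP <-; apply/eqP.
Qed.

Variable n : nat -> nat.
Hypothesis n_ge : forall k, (k <= n k)%N.

(** The average equals [(1 - w ^+ (p ^ n k))^-1], and by [cvg_iter_pow] the power of [w] tends to
    the constant value of the power of [om]. *)
Lemma cvg_avg_inv w om omq : v w <= 1 -> v (1 - w) = 1 -> v om <= 1 ->
  v (w - om) < 1 -> (forall k, om ^+ (p ^ n k) = omq) ->
  cvg_abs v (fun k => avg (p ^ n k) (fun z => z / (z - w))) (1 / (1 - omq)).
Proof.
move=> w1 ww om1 wom hom.
have om_unit : v (1 - omq) = 1.
  rewrite -(hom 0%N); apply: unit_sub_pow => //; rewrite -[RHS]ww.
  apply: (v_eq_near v_abs); rewrite ww.
  by have -> : 1 - om - (1 - w) = w - om by ring.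
have nz : 1 - omq != 0 by rewrite -(v_eq0 v_abs) om_unit oner_neq0.
move=> e e0; have [N hN] := cvg_iter_pow p_prime K_Cp w1 om1 wom n_ge e0.
exists N => k hk; rewrite (avg_inv p_prime K_Cp) ?pow_neq1 //.
have nzw : 1 - w ^+ (p ^ n k) != 0.
  by rewrite -(v_eq0 v_abs) unit_sub_pow // oner_neq0.
have -> : (1 - w ^+ (p ^ n k))^-1 - 1 / (1 - omq) =
    (w ^+ (p ^ n k) - omq) / ((1 - w ^+ (p ^ n k)) * (1 - omq)).
  by field; rewrite nz nzw.
rewrite v_div // vM // unit_sub_pow // om_unit mulr1 divr1.
by have := hN k hk; rewrite subr0 hom.
Qed.

Lemma cvg_avg_pow u j : cvg_abs v (fun k => avg (p ^ n k) (fun z => z * (z - u) ^+ j)) 0.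
Proof.
move=> e e0; exists j.+1 => k hk.
have lt : (j.+1 < p ^ n k)%N.
  apply: leq_ltn_trans hk _; apply: leq_ltn_trans (n_ge k) _.
  by apply: ltn_expl; rewrite prime_gt1.
by rewrite (avg_shifted_pow p_prime K_Cp) ?(ltn_eqF lt) ?subrr ?v0 // ltnW.
Qed.

Lemma cvg_avg_inv_pow u e : v u <= 1 -> v (1 - u) = 1 ->
  cvg_abs v (fun k => avg (p ^ n k) (fun z => z / (z - u) ^+ e.+2)) 0.
Proof.
move=> u1 uu d d0.
have [N hN] : exists N, forall k, (N <= k)%N -> forall i, (i < e.+1)%N ->
    v ('C(p ^ n k, i.+1)%:R) < d / 2.
  have d20 : 0 < d / 2 by rewrite divr_gt0.
  elim: {e}e.+1 => [|e [N hN]]; first by exists 0%N.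
  have [N' hN'] := cvg_bin p_prime K_Cp (ltn0Sn e) n_ge d20.
  exists (maxn N N') => k; rewrite geq_max => /andP[k1 k2] i.
  rewrite ltnS leq_eqVlt => /orP[/eqP ->|hi]; last exact: hN.
  by have := hN' k k2; rewrite subr0.
exists N => k hk; rewrite subr0; apply: (@le_lt_trans _ _ (d / 2)).
  apply: (avg_inv_pow_le p_prime K_Cp) => //; first by rewrite divr_ge0 // ltW.
    exact: unit_sub_pow.
  by case=> // i hi; apply/ltW/hN.
by rewrite ltr_pdivrMr // ltr_pMr // ltr1n.
Qed.

Lemma kernel_le1 N u w i m : v u <= 1 -> v (1 - u) = 1 -> v w <= 1 -> v (1 - w) = 1 ->
  v (avg (p ^ N) (fun z => z * ((z - u) ^+ i / (z - u) ^+ m) / (z - w))) <= 1.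
Proof.
move=> u1 uu w1 ww; apply: (avg_integral_le1 p_prime K_Cp) => //.
apply: (integral_onM K_Cp); last first.
  by apply: (integral_on_inv K_Cp) => //; apply: unit_sub_pow.
apply: (integral_onM K_Cp); first exact: (integral_onX K_Cp).
apply: (integral_onM K_Cp).
  exact/(integral_on_exp K_Cp)/(integral_on_sub K_Cp).
have [|G G1 eG] := integral_on_exp K_Cp m (integral_on_inv K_Cp (pn_gt0 N) u1 _).
  exact: unit_sub_pow.
by exists G => // z hz; rewrite -exprVn eG.
Qed.

(** Partial fractions in [z - u] and [z - w]. Polynomial terms and poles of order at least 2 average
    to 0 in the limit; the simple poles give [Mu] and [Mw]. *)
Lemma cvg_kernel u w Mu Mw i m : v u <= 1 -> v (1 - u) = 1 ->
  v w <= 1 -> v (1 - w) = 1 -> w != u ->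
  cvg_abs v (fun k => avg (p ^ n k) (fun z => z / (z - u))) Mu ->
  cvg_abs v (fun k => avg (p ^ n k) (fun z => z / (z - w))) Mw ->
  cvg_abs v (fun k => avg (p ^ n k)
      (fun z => z * ((z - u) ^+ i / (z - u) ^+ m) / (z - w)))
    ((w - u) ^+ i / (w - u) ^+ m * (Mw - (i < m)%N%:R * Mu)).
Proof.
move=> u1 uu w1 ww wu hu hw; have t0 : w - u != 0 by rewrite subr_eq0.
have nzu k z : z ^+ (p ^ n k) = 1 -> z - u != 0 by apply: unity_sub_neq0.
have nzw k z : z ^+ (p ^ n k) = 1 -> z - w != 0 by apply: unity_sub_neq0.
have [lei|lti] := leqP m i.
  rewrite mul0r subr0 -{2}(subnK lei) exprD mulfK ?expf_neq0 //.
  have -> : (fun k => avg (p ^ n k) (fun z => z * ((z - u) ^+ i / (z - u) ^+ m) / (z - w))) =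
      fun k => avg (p ^ n k) (fun z => z * (z - u) ^+ (i - m) / (z - w)).
    apply/funext => k; apply: eq_avg => z hz.
    by rewrite -{1}(subnK lei) exprD mulfK // expf_neq0 // (nzu k).
  elim: (i - m)%N => [|j IH].
    rewrite expr0 mul1r; under [X in cvg_abs _ X]funext => k.
      under eq_avg => z _ do rewrite mulr1.
      over.
    by [].
  (* One factor [z - u] is written as [(z - w) + (w - u)]: the first part cancels the pole, the
     second lowers the exponent. *)
  have -> : (fun k => avg (p ^ n k) (fun z => z * (z - u) ^+ j.+1 / (z - w))) =
      fun k => avg (p ^ n k) (fun z => z * (z - u) ^+ j) +
        (w - u) * avg (p ^ n k) (fun z => z * (z - u) ^+ j / (z - w)).
    apply/funext => k; rewrite -(avgZ p_prime K_Cp) // -(avgD p_prime K_Cp) //.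
    by apply: eq_avg => z hz; rewrite exprS; field; apply: (nzw k).
  rewrite exprS -mulrA -[X in cvg_abs _ _ X]add0r.
  by apply: cvg_absD => //; [apply: cvg_avg_pow|apply: cvg_absZ].
rewrite mul1r.
have -> : (fun k => avg (p ^ n k) (fun z => z * ((z - u) ^+ i / (z - u) ^+ m) / (z - w))) =
    fun k => avg (p ^ n k) (fun z => z / (z - u) ^+ (m - i) / (z - w)).
  apply/funext => k; apply: eq_avg => z hz; have z0 := nzu k z hz.
  rewrite -{1}(subnK (ltnW lti)) exprD; congr (_ * _ / _).
  by field; rewrite !expf_neq0.
have -> : (w - u) ^+ i / (w - u) ^+ m = (w - u)^-1 ^+ (m - i).
  rewrite -{1}(subnK (ltnW lti)) exprD exprVn.
  by field; rewrite !expf_neq0.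
move: lti; rewrite -subn_gt0; case: (m - i)%N => // j _.
(* The same splitting of [w - u] lowers the order of the pole at [u]; the separated pole matters in
   the limit only when [j' = 0]. *)
have rec j' : (fun k => avg (p ^ n k) (fun z => z / (z - u) ^+ j'.+1 / (z - w))) =
    fun k => (w - u)^-1 * (avg (p ^ n k) (fun z => z / (z - u) ^+ j' / (z - w)) -
      avg (p ^ n k) (fun z => z / (z - u) ^+ j'.+1)).
  apply/funext => k; rewrite -(avgB p_prime K_Cp) // -(avgZ p_prime K_Cp) //.
  apply: eq_avg => z hz; have [z0 z1] := (nzu k z hz, nzw k z hz).
  by rewrite exprS; field; rewrite t0 z0 z1 expf_neq0.
have cvgB a b la lb : cvg_abs v a la -> cvg_abs v b lb ->
    cvg_abs v (fun k => a k - b k) (la - lb).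
  move=> ha hb; rewrite -mulN1r.
  under [X in cvg_abs _ X]funext do rewrite -mulN1r.
  by apply: cvg_absD => //; apply: cvg_absZ.
elim: j => [|j IH].
  rewrite rec expr1; apply: cvg_absZ => //; apply: cvgB => //.
  have -> // : (fun k => avg (p ^ n k) (fun z => z / (z - u) ^+ 0 / (z - w))) =
            fun k => avg (p ^ n k) (fun z => z / (z - w)).
  by apply/funext => k; apply: eq_avg => z _; rewrite expr0 divr1.
rewrite rec exprS -mulrA; apply: cvg_absZ => //.
rewrite -[X in cvg_abs _ _ X]subr0; apply: cvgB => //.
exact: cvg_avg_inv_pow.
Qed.

End KernelLimit.

(** * Approximation by Laurent polynomials on a circle *)

Section LaurentApproximation.
Context {R : realType} {K : fieldType}.
Variables (v : K -> R) (p : nat).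
Hypotheses (p_prime : prime p) (K_Cp : is_Cp v p).

Let v_abs : ultrametric_abs v := Cp_abs K_Cp.

(* A coefficient is an average over the [M]-th roots of unity, and no
   denominator appears in the bound when [M] is prime to [p]. *)
Lemma coef_le_sup (P : {poly K}) (s : R) i :
  (forall y, v y = 1 -> v P.[y] <= s) -> v P`_i <= s.
Proof.
move=> hP; have s0 : 0 <= s by apply: le_trans (hP 1 (v1 v_abs)); rewrite v_ge0.
have [hi|hi] := leqP (size P) i; first by rewrite nth_default ?v0.
(* [M] is 1 modulo [p], and it exceeds every exponent of [P], so it divides [M - i + j] only for
   [j = i]. *)
pose M := (size P * p + 1)%N.
have lM j : (j < size P)%N -> (j < M)%N.
  by move=> hj; rewrite /M addn1 ltnS (leq_trans (ltnW hj)) // leq_pmulr // prime_gt0.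
have M0 : (0 < M)%N by rewrite /M addn1.
have M1 : v M%:R = 1 by rewrite (v_coprime p_prime K_Cp) // /coprime gcdnMDl gcdn1.
have -> : P`_i = avg M (fun z => z ^+ (M - i) * P.[z]).
  transitivity (avg M (fun z => \sum_(j < size P) P`_j * z ^+ (M - i + j))).
    rewrite (avg_sum p_prime K_Cp) // (bigD1 (Ordinal hi)) //= big1 => [|j ji].
      rewrite (avgZ p_prime K_Cp) // (avg_monomial p_prime K_Cp) //.
      by rewrite (subnK (ltnW (lM i hi))) dvdnn mulr1 addr0.
    rewrite (avgZ p_prime K_Cp) // (avg_monomial p_prime K_Cp) //.
    have iM := lM i hi; have jM := lM j (ltn_ord j).
    have ne : (j : nat) != i by apply: contraNneq ji => h; apply/eqP/val_inj.
    case: dvdnP => [[k hk]|_]; last by rewrite mulr0.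
    have : (k == 1)%N.
      by move: hk ne; case: k => [|[|k]] //; rewrite ?mulSn; lia.
    by move=> /eqP k1; move: hk ne; rewrite k1 mul1n; lia.
  apply: eq_avg => z _; rewrite horner_coef mulr_sumr; apply: eq_bigr => j _.
  by rewrite exprD mulrCA.
apply: (le_trans (avg_le p_prime K_Cp (B := s) M0 _)) => [z hz|]; last by rewrite vV // M1 invr1 mul1r.
have z1 : v z = 1 by apply: (v_unity v_abs M0).
by rewrite vM // vX // z1 expr1n mul1r hP.
Qed.

(** The pair of [P] and [m] encodes the Laurent polynomial [P / 'X^m]. *)
Definition laurent_approx (h : K -> K) := forall e : R, 0 < e ->
  exists (P : {poly K}) (m : nat), forall y, v y = 1 -> v (h y - P.[y] / y ^+ m) < e.

Lemma laurent_bounded (P : {poly K}) m :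
  exists2 B : R, 0 < B & forall y, v y = 1 -> v (P.[y] / y ^+ m) <= B.
Proof.
exists (1 + \sum_(i < size P) v P`_i).
  by rewrite ltr_pwDl // sumr_ge0 // => i _; rewrite v_ge0.
move=> y y1; rewrite v_div // vX // y1 expr1n divr1 horner_coef.
have ge0 (J : pred 'I_(size P)) : 0 <= \sum_(i < size P | J i) v P`_i.
  by apply: sumr_ge0 => j _; rewrite v_ge0.
apply: v_sum_le => // [|i _]; first by rewrite addr_ge0 ?ge0.
rewrite vM // vX // y1 expr1n mulr1 (bigD1 i) //=.
have := ge0 (fun j => j != i); lra.
Qed.

Lemma laurent_approx_poly (P : {poly K}) : laurent_approx (horner P).
Proof.
move=> e e0; exists P, 0%N => y _; by rewrite expr0 divr1 subrr v0.
Qed.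

Lemma laurent_approxM h h' :
  laurent_approx h -> laurent_approx h' -> laurent_approx (fun y => h y * h' y).
Proof.
(* This first approximation of [h'] only yields a bound for [h']; the final one, [P'], is chosen
   after [P], since its tolerance depends on a bound for [P]. *)
move=> H H' e e0; have [P1 [m1 h1]] := H' 1 ltr01.
have [B B0 hB] := laurent_bounded P1 m1; pose B' := Num.max 1 B.
have B'0 : 0 < B' by rewrite lt_max ltr01.
have h'B y : v y = 1 -> v (h' y) <= B'.
  move=> y1; rewrite -(subrK (P1.[y] / y ^+ m1) (h' y)); apply: vD_le => //.
    by rewrite (le_trans (ltW (h1 y y1))) // le_max lexx.
  by rewrite (le_trans (hB y y1)) // le_max lexx orbT.
have [P [m hP]] := H (e / B') (divr_gt0 e0 B'0).
have [C C0 hC] := laurent_bounded P m.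
have [P' [m' hP']] := H' (e / C) (divr_gt0 e0 C0).
exists (P * P'), (m + m')%N => y y1; have y0 : y != 0 by rewrite -(v_gt0 v_abs) y1.
rewrite hornerM exprD -mulf_div.
set a := P.[y] / _; set a' := P'.[y] / _.
have -> : h y * h' y - a * a' = (h y - a) * h' y + a * (h' y - a') by ring.
apply: vD_lt => //; rewrite vM //.
  apply: (@le_lt_trans _ _ (v (h y - a) * B')); first by rewrite ler_wpM2l ?v_ge0 ?h'B.
  by rewrite -ltr_pdivlMr // hP.
apply: (@le_lt_trans _ _ (C * v (h' y - a'))); first by rewrite ler_wpM2r ?v_ge0 ?hC.
by rewrite mulrC -ltr_pdivlMr // hP'.
Qed.

(** Truncated geometric series: in [c / y] when [v c < 1], in [y / c] when [v c > 1]. *)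
Lemma laurent_approx_inv c : v c != 1 -> laurent_approx (fun y => (y - c)^-1).
Proof.
move=> c1 e e0.
pose P n := \poly_(i < n) c ^+ (n.-1 - i).
have PE n y : (y - c) * (P n).[y] = y ^+ n - c ^+ n.
  rewrite /P horner_poly subrXX_comm; last exact: mulrC.
  congr (_ * _); rewrite [RHS](reindex_inj rev_ord_inj) /=.
  apply: eq_bigr => i _; rewrite mulrC; congr (_ ^+ _ * _ ^+ _); have := ltn_ord i; lia.
have [lt|gt] : v c < 1 \/ 1 < v c by move: c1; rewrite neq_lt => /orP[]; [left|right].
  have [|n hn] := @expr_lt_eps R (v c) e _ e0; first by rewrite v_ge0.
  exists (P n), n => y y1; have y0 : y != 0 by rewrite -(v_gt0 v_abs) y1.
  have vyc : v (y - c) = 1 by rewrite -y1; apply: (vDl v_abs); rewrite (vN v_abs) y1.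
  have yc : y - c != 0 by rewrite -(v_gt0 v_abs) vyc.
  have -> : (y - c)^-1 - (P n).[y] / y ^+ n = c ^+ n / ((y - c) * y ^+ n).
    have -> : c ^+ n = y ^+ n - (y - c) * (P n).[y] by rewrite PE; ring.
    by field; rewrite yc expf_neq0.
  by rewrite v_div // vM // vyc !(vX v_abs) y1 expr1n mulr1 divr1.
have c0 : c != 0 by rewrite -(v_gt0 v_abs) (lt_trans ltr01).
have vc0 : 0 < v c by rewrite (lt_trans ltr01).
have [|n hn] := @expr_lt_eps R (v c)^-1 e _ e0.
  by rewrite invr_ge0 v_ge0 // invf_lt1.
exists (- (c ^+ n)^-1 *: P n), 0%N => y y1; rewrite expr0 divr1.
have vyc : v (y - c) = v c by rewrite vBC //; apply: (vDl v_abs); rewrite (vN v_abs) y1.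
have yc : y - c != 0 by rewrite -(v_gt0 v_abs) vyc.
have -> : (y - c)^-1 - (- (c ^+ n)^-1 *: P n).[y] = y ^+ n / ((y - c) * c ^+ n).
  have -> : y ^+ n = c ^+ n + (y - c) * (P n).[y] by rewrite PE; ring.
  by rewrite hornerZ; field; rewrite yc expf_neq0.
rewrite v_div // vM // vyc !(vX v_abs) y1 expr1n mul1r invfM; apply: le_lt_trans hn.
by rewrite exprVn ler_piMl ?invr_ge0 ?exprn_ge0 ?v_ge0 // invf_le1 // ltW.
Qed.

Lemma laurent_approx_ext h h' : (forall y, v y = 1 -> h y = h' y) ->
  laurent_approx h -> laurent_approx h'.
Proof.
move=> E H e e0; have [P [m hP]] := H e e0; exists P, m => y y1; rewrite -E //.
exact: hP.
Qed.

(** The denominator splits over [K] and has no root on the unit circle, so it is inverted one linear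
    factor at a time. *)
Lemma laurent_approx_rational (P Q : {poly K}) : (forall y, v y = 1 -> Q.[y] != 0) ->
  laurent_approx (fun y => P.[y] / Q.[y]).
Proof.
move=> hQ; apply: laurent_approxM; first exact: laurent_approx_poly.
have Q0 : Q != 0 by apply: contraNneq (hQ 1 (v1 v_abs)) => ->; rewrite horner0.
have [rs eQ] := Cp_split p_prime K_Cp Q0.
apply: (@laurent_approx_ext (fun y => ((lead_coef Q)^-1)%:P.[y] * \prod_(c <- rs) (y - c)^-1)).
  move=> y _; rewrite {2}eQ hornerZ hornerC invfM horner_prod prodfV.
  by congr (_ * _); under [in RHS]eq_bigr do rewrite hornerXsubC.
apply: laurent_approxM; first exact: laurent_approx_poly.
have : forall c, c \in rs -> v c != 1.
  move=> c crs; apply/eqP => /hQ /negP[]; apply/eqP/rootP.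
  by rewrite eQ rootZ ?lead_coef_eq0 // root_prod_XsubC.
elim: rs {eQ} => [|c rs IH] hrs.
  apply: (laurent_approx_ext _ (laurent_approx_poly 1)) => y _.
  by rewrite big_nil hornerC.
apply: (@laurent_approx_ext (fun y => (y - c)^-1 * \prod_(c <- rs) (y - c)^-1)).
  by move=> y _; rewrite big_cons.
apply: laurent_approxM; first by apply: laurent_approx_inv; rewrite hrs ?mem_head.
by apply: IH => d drs; rewrite hrs // inE drs orbT.
Qed.

(** A rational approximation of [f] is pulled back to the unit circle by the affine map [T] and
    approximated there. *)
Lemma krasner_laurent (x1 b : K) (r : R) (f : K -> K) (e : R) :
  0 < r -> v (b - x1) = r ->
  krasner_analytic v (closed_disc v x1 r `\` open_disc v x1 r) f -> 0 < e ->
  exists (P : {poly K}) (m : nat), forall x, v (x - x1) = r ->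
    v (f x - P.[(x - x1) / (b - x1)] / ((x - x1) / (b - x1)) ^+ m) < e.
Proof.
move=> r0 br [g [gD hg]] e0; have [N /(_ N (leqnn N)) hN] := hg e e0.
have DE x : v (x - x1) = r -> (closed_disc v x1 r `\` open_disc v x1 r) x.
  by move=> h; split; rewrite /closed_disc /open_disc /= h // ltxx.
have b0 : b - x1 != 0 by rewrite -(v_gt0 v_abs) br.
pose T := x1%:P + (b - x1) *: 'X : {poly K}.
have TE y : T.[y] = x1 + (b - x1) * y by rewrite !hornerE.
have vT y : v y = 1 -> v (T.[y] - x1) = r.
  by move=> y1; rewrite TE addrC addKr vM // br y1 mulr1.
have [|P [m hP]] := @laurent_approx_rational ((g N).1 \Po T) ((g N).2 \Po T) _ e e0.
  by move=> y y1; rewrite horner_comp; apply/gD/DE/vT.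
exists P, m => x hx; set y := _ / (b - x1).
have y1 : v y = 1 by rewrite v_div // hx br divff // gt_eqF.
have Ty : T.[y] = x by rewrite TE mulrC divfK // addrC subrK.
have := hP y y1; rewrite !horner_comp Ty; apply: (v_dist_lt v_abs).
exact/hN/DE.
Qed.

End LaurentApproximation.

(** * Arc integrals of Krasner analytic functions *)

Section Arcs.
Context {R : realType} {K : fieldType}.
Variables (v : K -> R) (p : nat).
Hypotheses (p_prime : prime p) (K_Cp : is_Cp v p).

Let v_abs : ultrametric_abs v := Cp_abs K_Cp.

(** The two path sequences share a subsequence by interlocking; far along it both approximations
    hold for the same arc sum. *)
Lemma arc_integral_unique a b F f L L' :
  is_arc_integral v p a b F f L -> is_arc_integral v p a b F f L' -> L = L'.
Proof.
move=> h h'; apply/eqP; rewrite -subr_eq0 -(v_eq0 v_abs) eq_le v_ge0 // andbT.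
apply/ler_addgt0Pr => e e0; rewrite add0r; apply: ltW.
have [phi Fphi [N hN]] := h e e0; have [phi' Fphi' [N' hN']] := h' e e0.
have [psi _ [k0 [_ [g [gi hg]] [g' [gi' hg']]]]] := il_interlocked Fphi Fphi'.
have grow (G : nat -> nat) : (forall k l, (k0 <= k)%N -> (k < l)%N -> (G k < G l)%N) ->
    forall j, (j <= G (k0 + j))%N.
  move=> Gi; elim=> // j; rewrite addnS => IH; apply: leq_ltn_trans IH _.
  by apply: Gi; rewrite ?leq_addr.
pose k := (k0 + (N + N').+1)%N.
have k0k : (k0 <= k)%N by rewrite leq_addr.
have [s e1] := hg k k0k; have [s' e2] := hg' k k0k.
have gN : (N < g k)%N by apply: leq_trans (grow g gi _); rewrite ltnS leq_addr.
have gN' : (N' < g' k)%N by apply: leq_trans (grow g' gi' _); rewrite ltnS leq_addl.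
apply: (v_dist_lt v_abs (y := arc_sum p a b f phi (g k))); first by rewrite vBC // hN.
have -> : arc_sum p a b f phi (g k) = arc_sum p a b f phi' (g' k).
  by rewrite /arc_sum -e1 -e2.
exact: hN'.
Qed.

Lemma arc_integralE a b F f L : is_arc_integral v p a b F f L ->
  arc_integral v p a b F f = L.
Proof.
move=> h; apply: (@arc_integral_unique a b F f) => //.
exact: (@xgetPex K 0 [set L | is_arc_integral v p a b F f L] (ex_intro _ L h)).
Qed.

Definition arc_avg (a b : K) (N : nat) (f : K -> K) : K :=
  avg (p ^ N) (fun zeta => let x := a + (b - a) * zeta in (x - a) * f x).

Let pn_gt0 n : (0 < p ^ n)%N.
Proof. by rewrite expn_gt0 prime_gt0. Qed.

Variables (x1 b z : K) (r : R) (r_gt0 : 0 < r).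
Hypotheses (b_x1 : v (b - x1) = r) (z_x1 : v (z - x1) = r) (z_b : v (z - b) = r).

Let Y x := (x - x1) / (b - x1).

Definition laurent_kernel (P : {poly K}) (m : nat) (x : K) : K :=
  P.[Y x] / Y x ^+ m / (x - z).

Section OneArc.
Variables (a : K) (a_b : v (a - b) = r) (a_x1 : v (a - x1) <= r).

(** The value of [zeta] at which [a + (b - a) * zeta] equals [c]. *)
Definition arc_coord (c : K) := (a - c) / (a - b).

Let w := arc_coord z.
Let u := arc_coord x1.
(** The ratio of the two coordinates: at [x = a + (b - a) * y] one has [Y x = kappa * (y - u)]. *)
Let kappa := (b - a) / (b - x1).

Lemma arc_coord_le1 c : v (a - c) <= r -> v (arc_coord c) <= 1.
Proof. by move=> h; rewrite v_div // a_b ler_pdivrMr // mul1r. Qed.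

Lemma arc_coord_unit c : v (c - b) = r -> v (1 - arc_coord c) = 1.
Proof.
have ab0 : a - b != 0 by rewrite -(v_gt0 v_abs) a_b.
move=> h; have -> : 1 - arc_coord c = (c - b) / (a - b) by rewrite /arc_coord; field.
by rewrite v_div // h a_b divff // gt_eqF.
Qed.

Let az : v (a - z) <= r.
Proof. by apply: (v_dist_le v_abs a_x1); rewrite vBC // z_x1. Qed.

Let w1 : v w <= 1. Proof. exact: arc_coord_le1. Qed.
Let ww : v (1 - w) = 1. Proof. exact: arc_coord_unit. Qed.
Let u1 : v u <= 1. Proof. exact: arc_coord_le1. Qed.
Let uu : v (1 - u) = 1. Proof. by apply: arc_coord_unit; rewrite vBC. Qed.

Let wu : w - u = (x1 - z) / (a - b).
Proof. by rewrite /w /u /arc_coord -mulrBl; congr (_ / _); ring. Qed.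

Let w_neq_u : w != u.
Proof.
rewrite -subr_eq0 wu -(v_eq0 v_abs) v_div // vBC // z_x1 a_b.
by rewrite divff ?oner_neq0 // gt_eqF.
Qed.

Let kappa1 : v kappa = 1.
Proof. by rewrite v_div // vBC // a_b b_x1 divff // gt_eqF. Qed.

(** A root of unity of p-power order is congruent to 1, so [x] is closer than [r] to [b] and
    inherits the distances of [b] to [x1] and [z]. *)
Lemma arc_point N zeta : zeta ^+ (p ^ N) = 1 ->
  let x := a + (b - a) * zeta in
  [/\ v (x - x1) = r, v (x - a) = r & v (x - z) = r].
Proof.
move=> hz x; have z1 : v zeta = 1 by apply: (v_unity v_abs (pn_gt0 N)).
have zz : v (zeta - 1) < 1.
  by apply: (v_sub1_iter p_prime K_Cp (n := N)); rewrite ?z1 // hz subrr v0.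
have xb : v (x - b) < r.
  have -> : x - b = (b - a) * (zeta - 1) by rewrite /x; ring.
  by rewrite vM // (vBC v_abs b) a_b -ltr_pdivlMl // mulVf // gt_eqF.
split.
- by rewrite -b_x1; apply: (v_eq_near v_abs); rewrite b_x1 opprB addrA subrK.
- by rewrite /x addrC addKr vM // z1 mulr1 vBC.
- rewrite -z_b (vBC v_abs z); apply: (v_eq_near v_abs); rewrite (vBC v_abs b) z_b.
  by rewrite opprB addrA subrK.
Qed.

Lemma arc_avg_laurent N P m : arc_avg a b N (laurent_kernel P m) =
  \sum_(i < size P) (P`_i * (kappa ^+ i / kappa ^+ m)) *
    avg (p ^ N) (fun y => y * ((y - u) ^+ i / (y - u) ^+ m) / (y - w)).
Proof.
rewrite /arc_avg.
transitivity (avg (p ^ N) (fun y => \sum_(i < size P) (P`_i * (kappa ^+ i / kappa ^+ m)) *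
    (y * ((y - u) ^+ i / (y - u) ^+ m) / (y - w)))).
  apply: eq_avg => y hy /=; rewrite /laurent_kernel; set x := a + (b - a) * y.
  have ab0 : a - b != 0 by rewrite -(v_gt0 v_abs) a_b.
  have ba0 : b - a != 0 by rewrite -(v_gt0 v_abs) vBC // a_b.
  have bx0 : b - x1 != 0 by rewrite -(v_gt0 v_abs) b_x1.
  have yu : y - u != 0 by apply: (unity_sub_neq0 p_prime K_Cp u1 uu hy).
  have yw : y - w != 0 by apply: (unity_sub_neq0 p_prime K_Cp w1 ww hy).
  have Yx : Y x = kappa * (y - u).
    by rewrite /Y /kappa /u /arc_coord /x; field; rewrite bx0 ab0.
  have xz : x - z = (b - a) * (y - w) by rewrite /w /arc_coord /x; field.
  have xa : x - a = (b - a) * y by rewrite /x; ring.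
  rewrite xz xa Yx horner_coef !mulr_suml mulr_sumr; apply: eq_bigr => i _.
  have k0 : kappa != 0 by rewrite -(v_gt0 v_abs) kappa1.
  rewrite !exprMn; field.
  by rewrite ba0 yw !expf_neq0 ?invr_eq0.
rewrite (avg_sum p_prime K_Cp) //; apply: eq_bigr => i _.
by rewrite (avgZ p_prime K_Cp).
Qed.

(** The supremum bounds the coefficients by [coef_le_sup], and the averaged kernels are integral by
    [kernel_le1]; the bound is therefore uniform in [N]. *)
Lemma arc_avg_laurent_le N P m d : 0 <= d ->
  (forall x, v (x - x1) = r -> v (P.[Y x] / Y x ^+ m) <= d) ->
  v (arc_avg a b N (laurent_kernel P m)) <= d.
Proof.
move=> d0 hP; rewrite arc_avg_laurent; apply: v_sum_le => // i _.
have Pi : v P`_i <= d.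
  apply: (coef_le_sup p_prime K_Cp) => y y1.
  have bx0 : b - x1 != 0 by rewrite -(v_gt0 v_abs) b_x1.
  have Yy : Y (x1 + (b - x1) * y) = y by rewrite /Y addrAC subrr add0r mulrC mulKf.
  have := hP (x1 + (b - x1) * y); rewrite Yy v_div // vX // y1 expr1n divr1; apply.
  by rewrite addrAC subrr add0r vM // b_x1 y1 mulr1.
rewrite mulrC vM_le //; first exact: (kernel_le1 p_prime K_Cp).
by rewrite (vM v_abs) (v_div v_abs) !(vX v_abs) kappa1 !expr1n divr1 mulr1.
Qed.

(** A direct estimate loses [1 / p ^ N]. For each [N], a second Laurent polynomial within
    [d * v (p ^ N)%:R] of [f] absorbs that loss; it differs from the first by at most [d] on the
    circle, and [arc_avg_laurent_le] compares the two without loss. *)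
Lemma arc_avg_approx N f P m d : 0 < d ->
  krasner_analytic v (closed_disc v x1 r `\` open_disc v x1 r) f ->
  (forall x, v (x - x1) = r -> v (f x - P.[Y x] / Y x ^+ m) <= d) ->
  v (arc_avg a b N (fun x => f x / (x - z)) - arc_avg a b N (laurent_kernel P m)) <= d.
Proof.
move=> d0 fK hd; pose e := d * v (p ^ N)%:R.
have vN0 : 0 < v (p ^ N)%:R.
  by rewrite (v_gt0 v_abs) (Cp_pnatr_neq0 p_prime K_Cp).
have e0 : 0 < e by rewrite mulr_gt0.
have ed : e <= d by rewrite ler_piMr ?v_nat // ltW.
have [P' [m' hP']] := krasner_laurent p_prime K_Cp r_gt0 b_x1 fK e0.
rewrite -/(Y _) in hP'.
apply: (v_dist_le v_abs (y := arc_avg a b N (laurent_kernel P' m'))).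
  rewrite -(avgB p_prime K_Cp) //.
  have -> : d = v ((p ^ N)%:R^-1) * e by rewrite vV // mulrC mulfK // gt_eqF.
  apply: (avg_le p_prime K_Cp) => // y hy /=; have [xx1 xa xz] := arc_point hy.
  rewrite /laurent_kernel -mulrBr -mulrBl vM // v_div // xa xz mulrC divfK ?gt_eqF //.
  by apply/ltW/hP'.
rewrite -(avgB p_prime K_Cp) //.
have -> : avg (p ^ N) (fun y => (a + (b - a) * y - a) * laurent_kernel P' m' (a + (b - a) * y) -
    (a + (b - a) * y - a) * laurent_kernel P m (a + (b - a) * y)) =
    arc_avg a b N (laurent_kernel (P' * 'X^m - P * 'X^m') (m' + m)).
  apply: eq_avg => y hy /=; have [xx1 xa xz] := arc_point hy.
  rewrite /laurent_kernel; set x := a + _ in xx1 xa xz *.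
  have Y0 : Y x != 0.
    by rewrite -(v_gt0 v_abs) v_div // xx1 b_x1 divff ?gt_eqF.
  have xz0 : x - z != 0 by rewrite -(v_gt0 v_abs) xz.
  rewrite hornerD hornerN !hornerM !hornerXn exprD; field.
  by rewrite xz0 !expf_neq0.
apply: arc_avg_laurent_le => [|x hx]; first exact: ltW.
have Y0 : Y x != 0.
  by rewrite -(v_gt0 v_abs) v_div // hx b_x1 divff ?gt_eqF.
have -> : (P' * 'X^m - P * 'X^m').[Y x] / Y x ^+ (m' + m) =
    (f x - P.[Y x] / Y x ^+ m) - (f x - P'.[Y x] / Y x ^+ m').
  rewrite hornerD hornerN !hornerM !hornerXn exprD; field.
  by rewrite !expf_neq0.
apply: vB_le => //; first exact: hd.
by apply: le_trans ed; apply/ltW/hP'.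
Qed.

Variable n : nat -> nat.
Hypothesis n_ge : forall k, (k <= n k)%N.
Variables (Mu Mw : K).
Hypothesis cvg_u : cvg_abs v (fun k => avg (p ^ n k) (fun y => y / (y - u))) Mu.
Hypothesis cvg_w : cvg_abs v (fun k => avg (p ^ n k) (fun y => y / (y - w))) Mw.

(* The residue at [x1] comes from the negative powers of [Y] only, whence the
   condition [i < m] in front of [Mu]. *)
Definition laurent_arc_value (P : {poly K}) (m : nat) (Mu Mw : K) : K :=
  \sum_(i < size P) P`_i * (Y z ^+ i / Y z ^+ m) * (Mw - (i < m)%N%:R * Mu).

Lemma cvg_arc_laurent P m : cvg_abs v (fun k => arc_avg a b (n k) (laurent_kernel P m))
  (laurent_arc_value P m Mu Mw).
Proof.
under [X in cvg_abs _ X]funext do rewrite arc_avg_laurent.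
have -> : laurent_arc_value P m Mu Mw =
    \sum_(i < size P) (P`_i * (kappa ^+ i / kappa ^+ m)) *
      ((w - u) ^+ i / (w - u) ^+ m * (Mw - (i < m)%N%:R * Mu)).
  have -> : laurent_arc_value P m Mu Mw = \sum_(i < size P) P`_i * (Y z ^+ i / Y z ^+ m) *
     (Mw - (i < m)%N%:R * Mu) by [].
  apply: eq_bigr => i _; have -> : Y z = kappa * (w - u).
    rewrite wu /Y /kappa; field.
    by rewrite -!(v_gt0 v_abs) a_b b_x1 r_gt0.
  have k0 : kappa != 0 by rewrite -(v_gt0 v_abs) kappa1.
  have wu0 : w - u != 0 by rewrite subr_eq0.
  move: (w - u) kappa wu0 k0 => s t s0 t0.
  by rewrite !exprMn; field; rewrite !expf_neq0.
apply: cvg_abs_sum => // i; apply: cvg_absZ => //.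
exact: (cvg_kernel p_prime K_Cp).
Qed.

(** Uniform approximation makes the averages Cauchy. The limit is described only through Laurent
    polynomials near [f], which is the form in which the residue at [x1] can be eliminated. *)
Lemma arc_avg_cvg f :
  krasner_analytic v (closed_disc v x1 r `\` open_disc v x1 r) f ->
  exists L, cvg_abs v (fun k => arc_avg a b (n k) (fun x => f x / (x - z))) L /\
    forall P m d, 0 < d ->
      (forall x, v (x - x1) = r -> v (f x - P.[Y x] / Y x ^+ m) <= d) ->
      v (L - laurent_arc_value P m Mu Mw) <= d.
Proof.
move=> fK; have [L hL] : exists L,
    cvg_abs v (fun k => arc_avg a b (n k) (fun x => f x / (x - z))) L.
  apply: (Cp_complete K_Cp) => e e0; have e2 : 0 < e / 2 by rewrite divr_gt0.
  have e2e : e / 2 < e by rewrite ltr_pdivrMr // ltr_pMr // ltr1n.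
  have [P [m hP]] := krasner_laurent p_prime K_Cp r_gt0 b_x1 fK e2.
  have hPle x : v (x - x1) = r -> v (f x - P.[Y x] / Y x ^+ m) <= e / 2.
    by move=> hx; apply/ltW/hP.
  have [N hN] := cvg_arc_laurent P m e0; exists N => k l hk hl.
  have near j := le_lt_trans (arc_avg_approx (n j) e2 fK hPle) e2e.
  apply: (v_dist_lt v_abs (near k)); rewrite vBC //; apply: (v_dist_lt v_abs (near l)).
  by apply: (v_dist_lt v_abs (hN l hl)); rewrite vBC // hN.
exists L; split=> // P m d d0 hd.
have [N hN] := hL d d0; have [N' hN'] := cvg_arc_laurent P m d0.
pose k := maxn N N'.
apply: (v_dist_le v_abs (y := arc_avg a b (n k) (fun x => f x / (x - z)))).
  by rewrite vBC // ltW // hN // leq_maxl.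
apply: (v_dist_le v_abs (arc_avg_approx (n k) d0 fK hd)).
by rewrite ltW // hN' // leq_maxr.
Qed.

End OneArc.

End Arcs.

(** * Elements of finite multiplicative order *)

Section FiniteOrder.
Context {F : fieldType}.

Definition finite_order (w : F) := exists2 m, (0 < m)%N & w ^+ m = 1.

Lemma finite_order_prod (r : seq nat) (h : nat -> F) :
  (forall i, i \in r -> finite_order (h i)) -> finite_order (\prod_(i <- r) h i).
Proof.
elim: r => [|i r IH] hr; first by exists 1%N => //; rewrite big_nil expr1n.
have [m m0 hm] := hr i (mem_head _ _).
have [m' m'0 hm'] : finite_order (\prod_(i <- r) h i).
  by apply: IH => j jr; apply: hr; rewrite inE jr orbT.
exists (m * m')%N; first by rewrite muln_gt0 m0.
by rewrite big_cons exprMn exprM hm expr1n mul1r mulnC exprM hm' expr1n.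
Qed.

(** Both sides are the value at 1 of the quotient of ['X^N - 1] by ['X - 1]. *)
Lemma prod_one_sub_prim_root N (e : F) : N.-primitive_root e ->
  \prod_(1 <= i < N) (1 - e ^+ i) = N%:R.
Proof.
move=> eN; have N0 := prim_order_gt0 eN.
have h := factor_Xn_sub_1 eN; rewrite big_ltn // expr0 in h.
have X1 : ('X - 1%:P : {poly F}) != 0 by rewrite polyXsubC_eq0.
have : \prod_(1 <= i < N) ('X - (e ^+ i)%:P) = \sum_(i < N) 'X^i.
  by apply: (mulfI X1); rewrite h polyC1 subrX1.
move/(congr1 (horner^~ 1)); rewrite horner_prod horner_sum.
under eq_bigr do rewrite hornerXsubC.
move=> ->; under eq_bigr do rewrite hornerXn expr1n.
by rewrite sumr_const card_ord.
Qed.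

End FiniteOrder.

(** * Choice of [a0] with nonzero determinant *)

Section Determinant.
Context {R : realType} {K : fieldType}.
Variables (v : K -> R) (p : nat).
Hypotheses (p_prime : prime p) (K_Cp : is_Cp v p).

Let v_abs : ultrametric_abs v := Cp_abs K_Cp.

Lemma teich_eq0 x : v x < 1 -> teichmuller v p x = 0.
Proof. by move=> h; rewrite /teichmuller (lt_eqF h). Qed.

Lemma teich_finite_order x : v x = 1 -> finite_order (teichmuller v p x).
Proof.
move=> x1; have [] := teich_spec p_prime K_Cp (x := x); first by rewrite x1.
rewrite x1 eqxx => _ [m _ hm].
by exists m; [apply: prim_order_gt0 hm|apply: prim_expr_order hm].
Qed.

Lemma teich_le1 x : v x <= 1 -> v (teichmuller v p x) <= 1.
Proof.
rewrite le_eqVlt => /orP[/eqP x1|/teich_eq0 ->]; last by rewrite v0 ?ler01.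
by have [m m0 hm] := teich_finite_order x1; rewrite (v_unity v_abs m0 hm).
Qed.

(** A single [lam] must serve all matrix entries; the product of their periods does. *)
Lemma teich_common_period (s : seq K) : (forall x, x \in s -> v x <= 1) ->
  exists2 lam, (0 < lam)%N &
    forall x, x \in s -> teichmuller v p x ^+ (p ^ lam) = teichmuller v p x.
Proof.
elim: s => [|x s IH] hs; first by exists 1%N.
have [|lam lam0 hlam] := IH; first by move=> y ys; rewrite hs // inE ys orbT.
have [mu mu0 hmu] : exists2 mu, (0 < mu)%N &
    teichmuller v p x ^+ (p ^ mu) = teichmuller v p x.
  have [_] := teich_spec p_prime K_Cp (hs x (mem_head _ _)).
  case: ifP => _; first exact: root_of_unity_period.
  by move=> ->; exists 1%N; rewrite // expr0n expn_eq0 eqn0Ngt prime_gt0.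
exists (lam * mu)%N; first by rewrite muln_gt0 lam0.
move=> y; rewrite inE => /predU1P[->|ys]; first exact: period_mul.
by rewrite mulnC; apply: period_mul; apply: hlam.
Qed.

(** The inequality expresses that the determinant is nonzero, its entry at [x1], [x1] being 1. *)
Lemma teich_det_neq0 (alpha : nat) (x1 b x0 : K) (r : R) : 0 < r ->
  v (b - x1) = r -> v (x0 - x1) = r -> v (x0 - b) = r ->
  let T x := teichmuller v p x ^+ (p ^ alpha) in
  let s := (x1 - x0) / (x1 - b) in
  exists a0, [/\ v (a0 - b) = r, v (a0 - x1) = r &
    (1 - T ((a0 - x0) / (a0 - b)))^-1 !=
    (1 - T ((a0 - x1) / (a0 - b)))^-1 * (1 - T s)^-1].
Proof.
move=> r0 bx1 x0x1 x0b T s; apply: contrapT => no.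
have xb0 : x1 - b != 0 by rewrite -(v_gt0 v_abs) vBC // bx1.
have s1 : v s = 1 by rewrite v_div // !(vBC v_abs x1) x0x1 bx1 divff // gt_eqF.
have es : 1 - s = (x0 - b) / (x1 - b) by rewrite /s; field.
have ss : v (1 - s) = 1 by rewrite es v_div // (vBC v_abs x1) x0b bx1 divff // gt_eqF.
pose y n := 1 - (1 - s) ^+ n.
have y1 : y 1%N = s by rewrite /y expr1; ring.
have vy n : v (y n) <= 1 by apply: vB_le; rewrite ?v1 // vX // ss expr1n.
have q0 : (p ^ alpha == 0)%N = false by rewrite expn_eq0 eqn0Ngt prime_gt0.
have T0 x : v x < 1 -> T x = 0 by move=> hx; rewrite /T teich_eq0 // expr0n q0.
have T1 x : v x = 1 -> finite_order (T x).
  move=> /teich_finite_order [m m0 hm]; exists m => //.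
  by rewrite /T exprAC hm expr1n.
(* The point [a] solves [(a - x1) / (a - b) = y n], and then [(a - x0) / (a - b) = y n.+1]; it is
   admissible because [y n] is a unit, and the vanishing determinant at [a] is the recurrence. *)
have rec n : v (y n) = 1 -> 1 - T (y n.+1) = (1 - T (y n)) * (1 - T s).
  move=> yn; have g0 : (1 - s) ^+ n != 0 by rewrite expf_neq0 // -(v_gt0 v_abs) ss.
  pose a := (x1 - y n * b) / (1 - y n).
  have e1 : 1 - y n = (1 - s) ^+ n by rewrite /y; ring.
  have ab : a - b = (x1 - b) / (1 - s) ^+ n.
    by rewrite /a e1 /y; field.
  have ax1 : a - x1 = y n * ((x1 - b) / (1 - s) ^+ n).
    by rewrite /a e1 /y; field.
  have ab0 : a - b != 0 by rewrite ab mulf_neq0 // invr_eq0.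
  have vab : v (a - b) = r by rewrite ab v_div // vX // ss expr1n divr1 vBC.
  have u1 : (a - x1) / (a - b) = y n by rewrite ax1 -ab mulfK.
  have u0 : (a - x0) / (a - b) = y n.+1.
    have -> : a - x0 = (a - x1) + s * (x1 - b) by rewrite /s divfK //; ring.
    by rewrite mulrDl u1 ab /y exprS; field; rewrite g0.
  apply: contrapT => ne; apply: no; exists a; split=> //.
    by rewrite ax1 -ab vM // yn mul1r.
  rewrite u0 u1 -invfM; apply/eqP => /invr_inj; exact: ne.
(* [N] is the order of the residue of [1 - s]. *)
have [N [N0 yN minN]] : exists N, [/\ (0 < N)%N, v (y N) < 1 &
    forall n, (0 < n < N)%N -> v (y n) = 1].
  have [m /andP[m0 _] hm] := residue_order p_prime K_Cp ss.
  have ex : exists m, (0 < m)%N && (v (y m) < 1) by exists m; rewrite m0 vBC.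
  case: (ex_minnP ex) => N /andP[N0 yN] minN; exists N; split=> // n /andP[n0 nN].
  apply/eqP; rewrite eq_le vy leNgt; apply/negP => yn.
  by have := minN n; rewrite n0 yn leqNgt nN => /(_ isT).
pose E := 1 - T s.
have pw n : (0 < n <= N)%N -> 1 - T (y n) = E ^+ n.
  elim: n => // -[|n] IH /andP[_ nN]; first by rewrite y1 expr1.
  rewrite rec; last by apply: minN; rewrite nN.
  by rewrite (IH (ltnW nN)) [RHS]exprSr.
have N1 : (1 < N)%N.
  rewrite ltn_neqAle N0 andbT; apply/eqP => N1.
  by move: yN; rewrite -N1 y1 s1 ltxx.
have EN : E ^+ N = 1 by rewrite -pw ?N0 ?leqnn // T0 // subr0.
have fin n : (0 < n < N)%N -> finite_order (1 - E ^+ n).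
  move=> hn; have /andP[n0 nN] := hn.
  by rewrite -pw ?n0 ?(ltnW nN) // opprB addrC subrK; apply/T1/minN.
(* If the order [m] of [E] were below [N], then [1 - E ^+ m = 0] would have finite order. *)
have EN' : N.-primitive_root E.
  have [m mE dv] := prim_order_exists N0 EN.
  have m0 := prim_order_gt0 mE.
  have := dvdn_leq N0 dv; rewrite leq_eqVlt => /orP[/eqP <- //|mN].
  have [k k0] := fin m (introT andP (conj m0 mN)).
  rewrite (prim_expr_order mE) subrr expr0n (gtn_eqF k0) => /eqP.
  by rewrite eq_sym oner_eq0.
have [k k0] : finite_order (\prod_(1 <= i < N) (1 - E ^+ i)).
  by apply: finite_order_prod => i; rewrite mem_index_iota; apply: fin.
rewrite prod_one_sub_prim_root // -natrX => /eqP.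
(* The integer [N > 1] would have finite order, against characteristic zero. *)
have Nk : (1 < N ^ k)%N by rewrite -(exp1n k) ltn_exp2r.
rewrite -subr_eq0 -(natrB _ (ltnW Nk)); apply/negP.
by apply: (Cp_pnatr_neq0 p_prime K_Cp); rewrite subn_gt0.
Qed.

End Determinant.

(** * Elimination of the residue at [x1] *)

Section KrasnerFormula.
Context {R : realType} {K : fieldType}.
Variables (v : K -> R) (p : nat).
Hypotheses (p_prime : prime p) (K_Cp : is_Cp v p).

Let v_abs : ultrametric_abs v := Cp_abs K_Cp.

Lemma arc_integrals_formula (alpha : nat) (x1 b x0 a0 z : K) (r : R) (f : K -> K) :
  0 < r -> v (b - x1) = r -> v (x0 - x1) = r -> v (x0 - b) = r ->
  v (a0 - b) = r -> v (a0 - x1) = r -> v (z - x0) < r ->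
  krasner_analytic v (closed_disc v x1 r `\` open_disc v x1 r) f ->
  let m a c := (1 - teichmuller v p ((a - c) / (a - b)) ^+ (p ^ alpha))^-1 in
  let g x := f x / (x - z) in
  exists L0 L1,
    [/\ is_arc_integral v p a0 b (Phi alpha%:Z) g L0,
        is_arc_integral v p x1 b (Phi alpha%:Z) g L1 &
        L0 - m a0 x1 * L1 = (m a0 x0 - m a0 x1 * m x1 x0) * f z].
Proof.
move=> r0 bx1 x0x1 x0b a0b a0x1 zx0 fK m g.
have zx1 : v (z - x1) = r.
  by rewrite -x0x1; apply: (v_eq_near v_abs); rewrite x0x1 opprB addrA subrK.
have zb : v (z - b) = r.
  by rewrite -x0b; apply: (v_eq_near v_abs); rewrite x0b opprB addrA subrK.
have x1b : v (x1 - b) = r by rewrite vBC.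
have x1x1 : v (x1 - x1) <= r by rewrite subrr v0 // ltW.
have coord a c : v (a - b) = r -> v (a - c) <= r -> v ((a - c) / (a - b)) <= 1.
  by move=> ab ac; apply: (arc_coord_le1 K_Cp r0 ab ac).
have a0x0 : v (a0 - x0) <= r.
  by apply: (v_dist_le v_abs (y := b)); rewrite ?a0b // vBC // x0b.
have x1x0 : v (x1 - x0) <= r by rewrite vBC // x0x1.
have a0x1' : v (a0 - x1) <= r by rewrite a0x1.
have [lam lam0 hlam] := @teich_common_period R K v p p_prime K_Cp
  [:: (a0 - x0) / (a0 - b); (a0 - x1) / (a0 - b); (x1 - x0) / (x1 - b); (x1 - x1) / (x1 - b)]
  ltac:(by move=> x; rewrite !inE => /or4P[] /eqP ->; apply: coord).
(* Along this member of the family, the [p ^ n k]-th powers of the Teichmuller values are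
   constant. *)
pose n k := (alpha + lam * k)%N.
have n_ge k : (k <= n k)%N by rewrite (leq_trans (leq_pmull k lam0)) // leq_addl.
have pow_n x k : teichmuller v p x ^+ (p ^ lam) = teichmuller v p x ->
    teichmuller v p x ^+ (p ^ n k) = teichmuller v p x ^+ (p ^ alpha).
  by move=> h; rewrite /n addnC expnD exprM mulnC (period_mul k h).
(* The pole lies at [c'] but the entry is that of [c]: as [v (c - c') < r], the Teichmuller value
   for [c] also represents the coordinate of [c']. This is used with [x0] and [z]. *)
have cvgM a c c' : v (a - b) = r -> v (a - c) <= r -> v (a - c') <= r ->
    v (c' - b) = r -> v (c - c') < r ->
    (a - c) / (a - b) \in [:: (a0 - x0) / (a0 - b); (a0 - x1) / (a0 - b);
                              (x1 - x0) / (x1 - b); (x1 - x1) / (x1 - b)] ->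
    cvg_abs v (fun k => avg (p ^ n k) (fun y => y / (y - arc_coord b a c'))) (m a c).
  move=> ab ac ac' c'b cc' inl; rewrite /m -[X in cvg_abs _ _ X]mul1r.
  apply: (cvg_avg_inv p_prime K_Cp n_ge (om := teichmuller v p ((a - c) / (a - b)))) => //.
  - exact: (arc_coord_le1 K_Cp r0).
  - exact: (arc_coord_unit K_Cp r0).
  - by apply: (teich_le1 p_prime K_Cp); apply: coord.
  - apply: (v_dist_lt v_abs (y := (a - c) / (a - b))).
      rewrite /arc_coord -mulrBl v_div // ab ltr_pdivrMr // mul1r.
      by rewrite opprB addrC addrA subrK.
    by have [] := teich_spec p_prime K_Cp (coord a c ab ac).
  - by move=> k; apply/pow_n/hlam.
have a0z : v (a0 - z) <= r.
  by apply: (v_dist_le v_abs a0x0); rewrite vBC // ltW.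
have x1z : v (x1 - z) <= r by rewrite vBC // zx1.
have x0z : v (x0 - z) < r by rewrite vBC.
have x11 : v (x1 - x1) < r by rewrite subrr v0.
have [L0 [cvg0 near0]] := arc_avg_cvg p_prime K_Cp r0 bx1 zx1 zb a0b a0x1' n_ge
  (cvgM a0 x1 x1 a0b a0x1' a0x1' x1b x11 ltac:(by rewrite !inE eqxx ?orbT))
  (cvgM a0 x0 z a0b a0x0 a0z zb x0z ltac:(by rewrite !inE eqxx ?orbT)) fK.
have [L1 [cvg1 near1]] := arc_avg_cvg p_prime K_Cp r0 bx1 zx1 zb x1b x1x1 n_ge
  (cvgM x1 x1 x1 x1b x1x1 x1x1 x1b x11 ltac:(by rewrite !inE eqxx ?orbT))
  (cvgM x1 x0 z x1b x1x0 x1z zb x0z ltac:(by rewrite !inE eqxx ?orbT)) fK.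
have [phi phi_start hphi] := Phi_member alpha%:Z lam0.
have phi_n k : (ps_start phi <= k)%N -> phi k = n k.
  by move=> hk; apply/eqP; rewrite -eqz_nat hphi // PoszD.
have integral a L : cvg_abs v (fun k => arc_avg p a b (n k) g) L ->
    is_arc_integral v p a b (Phi alpha%:Z) g L.
  move=> hL e e0; exists phi; first by exists lam.
  have [N hN] := hL e e0; exists N => k hk Nk.
  by have := hN k (ltnW Nk); rewrite /arc_avg -(phi_n k hk).
exists L0, L1; split; [exact: integral|exact: integral|].
have m11 : m x1 x1 = 1.
  rewrite /m subrr mul0r teich_eq0 ?v0 ?ltr01 //.
  by rewrite expr0n expn_eq0 eqn0Ngt prime_gt0 // subr0 invr1.
apply/eqP; rewrite -subr_eq0 -(v_eq0 v_abs) eq_le v_ge0 // andbT.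
set dt := m a0 x0 - _; apply/ler_addgt0Pr => e e0; rewrite add0r.
(* [C] dominates the coefficients of the three errors in the final decomposition. *)
pose C := Num.max 1 (Num.max (v (m a0 x1)) (v dt)).
have C0 : 0 < C by rewrite lt_max ltr01.
have C1 : 1 <= C by rewrite le_max lexx.
have d0 : 0 < e / C by rewrite divr_gt0.
have [P [k hP]] := krasner_laurent p_prime K_Cp r0 bx1 fK d0.
have hPle x (hx : v (x - x1) = r) := ltW (hP x hx).
(* The terms carrying the condition [i < m] cancel because [m x1 x1 = 1], leaving the Laurent
   polynomial evaluated at [z]. *)
have key : laurent_arc_value x1 b z P k (m a0 x1) (m a0 x0) -
    m a0 x1 * laurent_arc_value x1 b z P k (m x1 x1) (m x1 x0) =
    dt * (P.[(z - x1) / (b - x1)] / ((z - x1) / (b - x1)) ^+ k).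
  rewrite /laurent_arc_value horner_coef mulr_suml !mulr_sumr -sumrB.
  by apply: eq_bigr => i _; rewrite m11 /dt; ring.
have small c x : v c <= C -> v x <= e / C -> v (c * x) <= e.
  move=> hc hx; rewrite vM // (le_trans (ler_pM _ _ hc hx)) ?v_ge0 //.
  by rewrite mulrC divfK // gt_eqF.
set l0 := laurent_arc_value _ _ _ _ _ _ _ in key.
set l1 := laurent_arc_value _ _ _ _ _ _ _ in key.
set pz := _ / _ ^+ k in key.
have -> : L0 - m a0 x1 * L1 - dt * f z =
    (1 * (L0 - l0) - m a0 x1 * (L1 - l1)) - dt * (f z - pz).
  rewrite [dt * (_ - _)]mulrBr -key; ring.
apply: vB_le => //; first apply: vB_le => //.
- by apply: small; [rewrite v1|apply: near0 hPle].
- by apply: small; [rewrite !le_max lexx ?orbT|apply: near1 hPle].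
- by apply: small; [rewrite !le_max lexx ?orbT|apply: hPle].
Qed.

End KrasnerFormula.

(** * Determinant expansion and conclusion *)

Theorem theorem6p12 (R : realType) (p : nat) (K : fieldType) (v : K -> R)
    (p_prime : prime p) (p_odd : odd p) (K_Cp : is_Cp v p)
    (alpha : nat) (x1 : K) (r : R) (r_gt0 : 0 < r) (b x0 : K) :
  let D := closed_disc v x1 r `\` open_disc v x1 r in
  let M (a0 : K) : 'M[K]_2 :=
    teich_matrix v p alpha b (fun i : 'I_2 => [:: a0; x1]`_i)
                             (fun j : 'I_2 => [:: x0; x1]`_j) in
  D b -> D x0 -> v (x0 - b) = r ->
  (forall a0 : K,
     closed_disc v x1 r a0 -> v (a0 - b) = r -> v (a0 - x1) = r ->
     forall f : K -> K, krasner_analytic v D f ->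
     forall z : K, v (z - x0) < r -> \det (M a0) != 0 ->
     let g := fun x : K => f x / (x - z) in
     [/\ arc_integrable v p a0 b (Phi alpha%:Z) g,
         arc_integrable v p x1 b (Phi alpha%:Z) g
       & f z = 1 / \det (M a0) *
           (arc_integral v p a0 b (Phi alpha%:Z) g -
            1 / (1 - teichmuller v p ((a0 - x1) / (a0 - b)) ^+ (p ^ alpha)) *
            arc_integral v p x1 b (Phi alpha%:Z) g)]) /\
  (exists a0 : K,
     [/\ closed_disc v x1 r a0, v (a0 - b) = r, v (a0 - x1) = r
       & \det (M a0) != 0]).
Proof.
move=> D M Db Dx0 x0b.
have DE x : D x -> v (x - x1) = r.
  move=> [h1 h2]; apply/eqP; rewrite eq_le; apply/andP; split; first exact: h1.
  by rewrite leNgt; apply/negP.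
have [bx1 x0x1] := (DE b Db, DE x0 Dx0).
have v_abs := Cp_abs K_Cp.
pose m a c := (1 - teichmuller v p ((a - c) / (a - b)) ^+ (p ^ alpha))^-1.
have m11 : m x1 x1 = 1.
  rewrite /m subrr mul0r (teich_eq0 (v := v)) ?v0 ?ltr01 //.
  by rewrite expr0n expn_eq0 eqn0Ngt prime_gt0 // subr0 invr1.
have detE a0 : \det (M a0) = m a0 x0 - m a0 x1 * m x1 x0.
  rewrite (expand_det_row _ ord0) !big_ord_recl big_ord0 /cofactor !det_mx11 !mxE /=.
  rewrite !div1r addr0 -!/(m _ _) m11 /bump /=; ring.
split=> [a0 _ a0b a0x1 f fK z zx0 det0 g|].
  have [L0 [L1 [h0 h1 hf]]] :=
    arc_integrals_formula p_prime K_Cp alpha r_gt0 bx1 x0x1 x0b a0b a0x1 zx0 fK.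
  split; [by exists L0|by exists L1|].
  rewrite (arc_integralE K_Cp h0) (arc_integralE K_Cp h1) !div1r.
  by rewrite hf -detE mulKf.
have [a0 [a0b a0x1 ne]] := teich_det_neq0 p_prime K_Cp alpha r_gt0 bx1 x0x1 x0b.
exists a0; split=> //; first by rewrite /closed_disc /= a0x1.
by rewrite detE subr_eq0.
Qed.
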